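(* Suppose $F$ is a subequation on a manifold $X$. Assume that $X$ supports a $C^2$ function which is strictly $M$-subharmonic, where $M$ is a monotonicity cone for $F$. If local weak comparison holds for $F$ on $X$, then comparison holds for $F$ on $X$.
   Context: **Subequations.** $J^2(X)\to X$ is the bundle of 2-jets of real functions, $J^2_xu$ the 2-jet of $u$ at $x$. $\mathrm{Sym}^2(T^*X)\subset J^2(X)$ is the subbundle of 2-jets at $x$ of functions with value $0$ and differential $0$ at $x$; $\mathcal P\subset \mathrm{Sym}^2(T^*X)$ is the set of nonnegative forms; $\mathcal N\subset J^2(X)$ is the set of 2-jets of constant functions with value $\le 0$. Sums of subsets are fibrewise. A *subequation* on $X$ is a subset $F\subset J^2(X)$ with (P) $F+\mathcal P\subset F$; (N) $F+\mathcal N\subset F$; (T) $F=\overline{\mathrm{Int}\,F}$, $F_x=\overline{\mathrm{Int}\,F_x}$ and $\mathrm{Int}\,F_x=(\mathrm{Int}\,F)_x$ for all $x$ ($F_x$ is the fibre and $\mathrm{Int}\,F_x$ its interior in $J^2_x(X)$). The *dual* is $\widetilde F=\{J: -J\notin \mathrm{Int}\,F\}$. **Comparison.** $\mathrm{USC}(Y)$ is the set of upper semicontinuous functions $Y\to[-\infty,\infty)$. For $F\subset J^2(X)$ and open $Y\subset X$, $u\in F(Y)$ means $u\in\mathrm{USC}(Y)$ and, for each $x\in Y$ and each $\varphi$ of class $C^2$ near $x$ with $u-\varphi\le0$ near $x$ and $=0$ at $x$, one has $J^2_x\varphi\in F_x$. For compact $K$, $F(K)=\{u\in\mathrm{USC}(K):u|_{\mathrm{Int}K}\in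 F(\mathrm{Int}\,K)\}$. Fix a metric on the vector bundle $J^2(X)$; for $c>0$, $F^c_x=\{J\in F_x:\mathrm{dist}(J,J^2_x(X)\setminus F_x)\ge c\}$. For functions $u,v$ on a compact $K$, say $u+v$ satisfies (ZMP) on $K$ if $u+v\le0$ on $\partial K$ implies $u+v\le0$ on $K$. - *Comparison holds for $F$ on $X$* if for all compact $K\subset X$, $u\in F(K)$, $v\in\widetilde F(K)$, $u+v$ satisfies (ZMP) on $K$. - *Weak comparison holds for $F$ on $X$* if for all compact $K\subset X$, $c>0$, $u\in F^c(K)$, $v\in\widetilde F(K)$, $u+v$ satisfies (ZMP) on $K$. - *Local weak comparison holds for $F$ on $X$* if every $x\in X$ has a neighborhood $U$ such that weak comparison holds for $F$ on $U$. **Monotonicity cone.** A monotonicity cone for $F$ is a subset $M\subset J^2(X)$, each fibre of which is a convex cone with vertex at the origin, with $F+M\subset F$. A $C^2$ function $\psi$ is strictly $M$-subharmonic if $J^2_x\psi\in\mathrm{Int}\,M$ for all $x\in X$. *)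

(* Defs.v *)
From HB Require Import structures.
From mathcomp Require Import all_boot all_order all_algebra.
From mathcomp Require Import all_classical all_reals all_analysis.
Set Implicit Arguments.
Unset Strict Implicit.
Unset Printing Implicit Defensive.
Import Order.TTheory GRing.Theory Num.Theory numFieldNormedType.Exports.
Local Open Scope classical_set_scope.
Local Open Scope ring_scope.

(* f is of class C^k on V; only meaningful when V is open. *)
Fixpoint classC (R : realType) (n k : nat) (V : set 'rV[R]_n)
    (f : 'rV[R]_n -> R) : Prop :=
  (forall y, V y -> {for y, continuous f}) /\
  if k is k'.+1 then
    forall i : 'I_n,
      (forall y, V y -> derivable f y ('e_i : 'rV[R]_n)) /\
      classC k' V (fun y => 'D_('e_i : 'rV[R]_n) f y)
  else True.

(* cfun and cinv are total functions; their values outside cdom and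
   cfun @` cdom are irrelevant. *)
Record chart (R : realType) (n : nat) (X : topologicalType) := Chart {
  cdom : set X;
  cfun : X -> 'rV[R]_n;
  cinv : 'rV[R]_n -> X;
  cdom_open : open cdom;
  cimg_open : open (cfun @` cdom);
  cfunK : forall x, cdom x -> cinv (cfun x) = x;
  cfun_continuous : forall x, cdom x -> {for x, continuous cfun};
  cinv_continuous : forall y, (cfun @` cdom) y -> {for y, continuous cinv} }.

Record manifold (R : realType) (n : nat) := Manifold {
  carrier :> topologicalType;
  manifold_hausdorff : hausdorff_space carrier;
  manifold_second_countable : @second_countable carrier;
  atlas : set (chart R n carrier);
  atlas_cover : forall x : carrier, exists c, atlas c /\ cdom c x;
  atlas_smooth : forall c d, atlas c -> atlas d ->
    forall (k : nat) (j : 'I_n),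
      classC k (cfun c @` (cdom c `&` cdom d))
        (fun y => cfun d (cinv c y) 0 j) }.

Definition chart_at (R : realType) (n : nat) (X : manifold R n) (x : X) :
  chart R n X := sval (cid (atlas_cover x)).

Section SymmetricMatrices.
Context (R : realType) (n : nat).

Definition symm_pred : {pred 'M[R]_n} := [pred A | A^T == A].

Lemma symm_pred_submod_closed : submod_closed symm_pred.
Proof.
split=> [|a A B]; rewrite !inE ?trmx0// => /eqP AE /eqP BE.
by rewrite linearP/= AE BE.
Qed.

HB.instance Definition _ :=
  GRing.isSubmodClosed.Build R 'M[R]_n symm_pred symm_pred_submod_closed.

Record symm := Symm { symm_mx :> 'M[R]_n; symm_mxP : symm_mx \in symm_pred }.

HB.instance Definition _ := [isSub for symm_mx].
HB.instance Definition _ := [Choice of symm by <:].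
HB.instance Definition _ := [SubChoice_isSubLmodule of symm by <:].
HB.instance Definition _ := Topological.copy symm (initial_topology symm_mx).

Lemma symmetrize_subproof (A : 'M[R]_n) :
  2^-1 *: (A + A^T) \in symm_pred.
Proof. by rewrite inE linearZ/= linearD/= trmxK addrC. Qed.

Definition symmetrize (A : 'M[R]_n) : symm := Symm (symmetrize_subproof A).

End SymmetricMatrices.

(* The coordinates (value, gradient, Hessian) of a 2-jet in a chart. *)
Definition jetval (R : realType) (n : nat) : Type :=
  (R^o * 'rV[R]_n * symm R n)%type.

HB.instance Definition _ (R : realType) (n : nat) :=
  Topological.copy (jetval R n) (R^o * 'rV[R]_n * symm R n)%type.
HB.instance Definition _ (R : realType) (n : nat) :=
  GRing.Lmodule.copy (jetval R n) (R^o * 'rV[R]_n * symm R n)%type.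

(* The Hessian of a C^2 function is already symmetric; symmetrizing it makes
   the definition total in u. *)
Definition jet_in (R : realType) (n : nat) (X : topologicalType)
    (c : chart R n X) (u : X -> R) (x : X) : jetval R n :=
  let f := u \o cinv c in
  (u x,
   \row_i 'D_('e_i : 'rV[R]_n) f (cfun c x),
   symmetrize (\matrix_(i, j)
     'D_('e_i : 'rV[R]_n) (fun y => 'D_('e_j : 'rV[R]_n) f y) (cfun c x))).

Definition quad (R : realType) (n : nat) (A : 'M[R]_n) (h : 'rV[R]_n) : R :=
  (h *m A *m h^T) 0 0.

Section JetBundle.
Context (R : realType) (n : nat) (X : manifold R n).

(* The total space of J^2(X). The fibre over x is identified with jetval R n
   through the coordinates of the chart chart_at x. *)
Record J2 := Jet { jpos : X; jcomp : jetval R n }.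

Definition jet2 (u : X -> R) (x : X) : J2 := Jet x (jet_in (chart_at x) u x).

(* A function whose 2-jet at jpos J is J: the quadratic polynomial with the
   prescribed coefficients in the coordinates of chart_at (jpos J). *)
Definition jet_rep (J : J2) (y : X) : R :=
  let: (r, p, A) := jcomp J in
  let h := cfun (chart_at (jpos J)) y - cfun (chart_at (jpos J)) (jpos J) in
  r + (p *m h^T) 0 0 + 2^-1 * quad A h.

Definition jet_coord (c : chart R n X) (J : J2) : 'rV[R]_n * jetval R n :=
  (cfun c (jpos J), jet_in c (jet_rep J) (jpos J)).

(* The bundle topology: every chart c of the atlas identifies the jets over
   cdom c with an open subset of 'rV_n * jetval R n, via jet_coord c. *)
Definition jet_subbase : set (set J2) :=
  [set W | exists (c : chart R n X) (O : set ('rV[R]_n * jetval R n)),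
    [/\ atlas c, open O &
        W = [set J | cdom c (jpos J) /\ O (jet_coord c J)]]].

HB.instance Definition _ := gen_eqMixin J2.
HB.instance Definition _ := gen_choiceMixin J2.
HB.instance Definition _ :=
  @isSubBaseTopological.Build J2 (set J2) jet_subbase id.

Definition fibre (F : set J2) (x : X) : set (jetval R n) :=
  [set j | F (Jet x j)].

Definition fsum (A B : set J2) : set J2 :=
  [set J | exists a b, [/\ fibre A (jpos J) a, fibre B (jpos J) b &
                           jcomp J = a + b]].

Definition jetN (J : J2) : J2 := Jet (jpos J) (- jcomp J).

Definition posP : set J2 :=
  [set J | [/\ (jcomp J).1.1 = 0, (jcomp J).1.2 = 0 &
               forall h, 0 <= quad (jcomp J).2 h]].

Definition negN : set J2 :=
  [set J | exists2 r : R, r <= 0 & J = jet2 (cst r) (jpos J)].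

Definition subequation (F : set J2) : Prop :=
  [/\ fsum F posP `<=` F,
      fsum F negN `<=` F,
      F = closure (interior F),
      (forall x, fibre F x = closure (interior (fibre F x))) &
      (forall x, interior (fibre F x) = fibre (interior F) x)].

Definition dual (F : set J2) : set J2 := [set J | ~ interior F (jetN J)].

Definition C2_on (U : set X) (phi : X -> R) : Prop :=
  forall c : chart R n X, atlas c ->
    classC 2 (cfun c @` (U `&` cdom c)) (phi \o cinv c).

Definition C2_near (x : X) (phi : X -> R) : Prop :=
  exists U : set X, [/\ open U, U x & C2_on U phi].

(* Only the values of u on Y matter; here and below, functions on Y are
   represented by functions on X. *)
Definition usc (Y : set X) (u : X -> \bar R) : Prop :=
  forall x, Y x ->
    (u x < +oo)%E /\
    forall a : R, (u x < a%:E)%E ->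
      \forall y \near within Y (nbhs x), (u y < a%:E)%E.

(* u \in F(Y), for Y open. *)
Definition subharmonic (F : set J2) (Y : set X) (u : X -> \bar R) : Prop :=
  usc Y u /\
  forall x (phi : X -> R), Y x -> C2_near x phi ->
    (\forall y \near x, (u y - (phi y)%:E <= 0)%E) ->
    (u x - (phi x)%:E = 0)%E ->
    F (jet2 phi x).

(* u \in F(K), for K compact. *)
Definition subharmonic_cpt (F : set J2) (K : set X) (u : X -> \bar R) : Prop :=
  usc K u /\ subharmonic F (interior K) u.

Definition bundle_metric (g : X -> jetval R n -> jetval R n -> R) : Prop :=
  [/\ forall x a b, g x a b = g x b a,
      forall x (t : R) a b c, g x (t *: a + b) c = t * g x a c + g x b c,
      forall x a, a != 0 -> 0 < g x a a &
      continuous (fun J : J2 => g (jpos J) (jcomp J) (jcomp J))].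

(* The distance is +oo when the complement of the fibre is empty. *)
Definition dist_compl (g : X -> jetval R n -> jetval R n -> R)
    (F : set J2) (J : J2) : \bar R :=
  ereal_inf [set (Num.sqrt (g (jpos J) (jcomp J - j) (jcomp J - j)))%:E
            | j in ~` fibre F (jpos J)].

Definition shrink (g : X -> jetval R n -> jetval R n -> R)
    (F : set J2) (c : R) : set J2 :=
  [set J | F J /\ (c%:E <= dist_compl g F J)%E].

Definition ZMP (K : set X) (u v : X -> \bar R) : Prop :=
  (forall x, (closure K `\` interior K) x -> (u x + v x <= 0)%E) ->
  forall x, K x -> (u x + v x <= 0)%E.

Definition comparison (F : set J2) (Y : set X) : Prop :=
  forall (K : set X) (u v : X -> \bar R), compact K -> K `<=` Y ->
    subharmonic_cpt F K u -> subharmonic_cpt (dual F) K v -> ZMP K u v.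

Definition weak_comparison (g : X -> jetval R n -> jetval R n -> R)
    (F : set J2) (Y : set X) : Prop :=
  forall (K : set X) (c : R) (u v : X -> \bar R), compact K -> K `<=` Y ->
    0 < c -> subharmonic_cpt (shrink g F c) K u ->
    subharmonic_cpt (dual F) K v -> ZMP K u v.

Definition local_weak_comparison (g : X -> jetval R n -> jetval R n -> R)
    (F : set J2) : Prop :=
  forall x : X, exists2 U : set X, open_nbhs x U & weak_comparison g F U.

Definition monotonicity_cone (F M : set J2) : Prop :=
  [/\ forall x, convex_set (fibre M x),
      forall x (t : R) j, 0 < t -> fibre M x j -> fibre M x (t *: j) &
      fsum F M `<=` F].

Definition strictly_subharmonic (M : set J2) (psi : X -> R) : Prop :=
  forall x, interior M (jet2 psi x).

End JetBundle.

(* Main.v *)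
Require Import Defs.
From mathcomp Require Import all_boot all_order all_algebra.
From mathcomp Require Import all_classical all_reals all_analysis.
From mathcomp Require Import ring lra.
Set Implicit Arguments.
Unset Strict Implicit.
Unset Printing Implicit Defensive.
Import Order.TTheory GRing.Theory Num.Theory numFieldNormedType.Exports.
Local Open Scope classical_set_scope.
Local Open Scope ring_scope.

(** If [u + v] had a positive value on [K] while [u + v <= 0] on the boundary,
    then for small [eps > 0] the function [u + v + eps * psi] would attain its
    maximum over [K] at an interior point [x0].  Subtract [eps * delta * q],
    where [q] is the squared distance to [x0] in a chart, and a constant: since
    [Int M] is open, [psi - delta * q] is still strictly [M]-subharmonic near
    [x0] for small [delta], with a uniform margin in the bundle metric, so
    [u' = u + eps * (psi - delta * q) - m] is [F^c]-subharmonic on a small chart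
    box [B].  For a suitable [m], [u' + v] is nonpositive on the boundary of [B]
    but positive at [x0], against local weak comparison.  Only the maximum point
    matters, so no covering of [K] is needed.

    The margin requires working in the bundle topology: by the second-order
    chain rule the transition maps of [J2 X] are linear in the jet and
    continuous in the base point. *)

(** * Calculus of functions of class C^k on subsets of R^n *)

Section ClassC.
Context {R : realType} {n : nat}.
Implicit Types (V W : set 'rV[R]_n) (f g : 'rV[R]_n -> R).

Lemma classC_continuous k V f y : classC k V f -> V y -> {for y, continuous f}.
Proof. by case: k => [|k] [fc _]; exact: fc. Qed.

Lemma classC_derivable k V f y : classC k.+1 V f -> V y ->
  forall i, derivable f y ('e_i : 'rV[R]_n).
Proof. by move=> [_ fd] Vy i; have [+ _] := fd i; exact. Qed.

Lemma classC_derive k V f : classC k.+1 V f ->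
  forall i, classC k V (fun y => 'D_('e_i : 'rV[R]_n) f y).
Proof. by move=> [_ fd] i; have [] := fd i. Qed.

End ClassC.

Arguments classC_derivable {R n k V f y} _ _ i.
Arguments classC_derive {R n k V f} _ i.

Section ClassCOperations.
Context {R : realType} {n : nat}.
Implicit Types (V W : set 'rV[R]_n) (f g : 'rV[R]_n -> R).

Lemma classC_subset k V W f : W `<=` V -> classC k V f -> classC k W f.
Proof.
move=> WV; elim: k f => [|k IH] f [fc fd]; split => //.
- by move=> y /WV; exact: fc.
- by move=> y /WV; exact: fc.
- move=> i; have [dv c] := fd i; split; first by move=> y /WV; exact: dv.
  exact: IH.
Qed.

Lemma classCS k V f : classC k.+1 V f -> classC k V f.
Proof.
elim: k f => [|k IH] f [fc fd]; split => // i; have [dv c] := fd i.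
by split => //; exact: IH.
Qed.

Lemma near_eqfun_open V f g y : open V -> {in V, f =1 g} -> V y ->
  \forall z \near y, f z = g z.
Proof.
move=> oV fg Vy; apply: filterS (open_nbhs_nbhs (conj oV Vy)) => z Vz.
by apply: fg; rewrite inE.
Qed.

Lemma near_eq_continuous {T U : topologicalType} (f g : T -> U) (y : T) :
  (\forall z \near y, f z = g z) ->
  {for y, continuous f} -> {for y, continuous g}.
Proof.
move=> fg fc; rewrite /prop_for /continuous_at -(nbhs_singleton fg).
by apply: cvg_trans fc; apply: near_eq_cvg.
Qed.

(** Openness of [V] turns equality on [V] into equality near each of its points, so the partial
    derivatives agree on [V] too and induction applies. *)
Lemma eq_classC k V f g : open V -> {in V, f =1 g} ->
  classC k V f -> classC k V g.
Proof.
move=> oV; elim: k f g => [|k IH] f g fg [fc fd]; split => //.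
- by move=> y Vy; apply: near_eq_continuous (fc y Vy); exact: near_eqfun_open Vy.
- by move=> y Vy; apply: near_eq_continuous (fc y Vy); exact: near_eqfun_open Vy.
- move=> i; have [dv c] := fd i; split.
    move=> y Vy; apply: near_eq_derivable (dv y Vy).
    exact: near_eqfun_open Vy.
  apply: (IH _ _ _ c) => y; rewrite inE => Vy; apply: near_eq_derive.
  exact: near_eqfun_open Vy.
Qed.

Lemma classC_cst k V (a : R) : classC k V (cst a).
Proof.
elim: k a => [|k IH] a; split => //.
- by move=> y _; exact: cst_continuous.
- by move=> y _; exact: cst_continuous.
move=> i; split; first by move=> y _; exact: derivable_cst.
rewrite (_ : (fun y => _) = cst 0)//.
by apply/funext => y; rewrite derive_cst.
Qed.

Lemma classCD k V f g : open V ->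
  classC k V f -> classC k V g -> classC k V (fun y => f y + g y).
Proof.
move=> oV; elim: k f g => [|k IH] f g [fc fd] [gc gd]; split => //.
- by move=> y Vy; exact: cvgD (fc y Vy) (gc y Vy).
- by move=> y Vy; exact: cvgD (fc y Vy) (gc y Vy).
- move=> i; have [fdv fC] := fd i; have [gdv gC] := gd i; split.
    by move=> y Vy; exact: derivableD (fdv y Vy) (gdv y Vy).
  apply: eq_classC (IH _ _ fC gC) => // y; rewrite inE => Vy.
  by rewrite -[LHS]deriveD//; [exact: fdv|exact: gdv].
Qed.

Lemma classCM k V f g : open V ->
  classC k V f -> classC k V g -> classC k V (fun y => f y * g y).
Proof.
move=> oV; elim: k f g => [|k IH] f g fC gC; split => //.
- move=> y Vy; exact: cvgM (classC_continuous fC Vy) (classC_continuous gC Vy).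
- move=> y Vy; exact: cvgM (classC_continuous fC Vy) (classC_continuous gC Vy).
- move=> i; split.
    move=> y Vy; have := classC_derivable gC Vy i.
    by have := classC_derivable fC Vy i; exact: derivableM.
  apply: (@eq_classC _ _ (fun y => f y * 'D_('e_i : 'rV[R]_n) g y
      + g y * 'D_('e_i : 'rV[R]_n) f y)) => //.
    move=> y; rewrite inE => Vy.
    by rewrite -[LHS]deriveM//; [exact: (classC_derivable fC Vy i)
                                |exact: (classC_derivable gC Vy i)].
  apply: classCD => //; apply: IH;
    by [exact: classCS|exact: classC_derive].
Qed.

Lemma classCZ k V (a : R) f : open V ->
  classC k V f -> classC k V (fun y => a * f y).
Proof. by move=> oV fC; apply: classCM => //; exact: classC_cst. Qed.

Lemma classC_sum k V (I : Type) (s : seq I) (F : I -> 'rV[R]_n -> R) :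
  open V -> (forall i, classC k V (F i)) ->
  classC k V (fun y => \sum_(i <- s) F i y).
Proof.
move=> oV FC; elim: s => [|i s IH].
  by under eq_fun do rewrite big_nil; exact: classC_cst.
by under eq_fun do rewrite big_cons; exact: classCD.
Qed.

End ClassCOperations.

(** * Entrywise limits of matrices and limits of finite sums *)

Lemma cvg_mx {R : realType} {T : Type} (G : set_system T) {FG : Filter G} m n
    (f : T -> 'M[R]_(m, n)) (A : 'M[R]_(m, n)) :
  (forall i j, f t i j @[t --> G] --> A i j) -> f @ G --> A.
Proof.
move=> fA B [P PA PB].
have : \forall t \near G, forall i j, P i j (f t i j); last by apply: filterS => t /PB.
apply: filter_forall => i; apply: filter_forall => j.
exact: (fA i j _ (PA i j)).
Qed.

Lemma cvg_matrix {R : realType} {T : Type} (G : set_system T) {FG : Filter G} m n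
    (E : 'I_m -> 'I_n -> T -> R) (E0 : 'I_m -> 'I_n -> R) :
  (forall i j, E i j @ G --> E0 i j) ->
  \matrix_(i, j) E i j t @[t --> G] --> \matrix_(i, j) E0 i j.
Proof.
move=> EE0; apply: cvg_mx => i j; rewrite mxE.
by under eq_cvg do rewrite mxE; exact: EE0.
Qed.

Lemma cvg_coord {R : realType} {T : Type} (G : set_system T) {FG : Filter G}
    m n (f : T -> 'M[R]_(m, n)) (A : 'M[R]_(m, n)) i j :
  f @ G --> A -> f t i j @[t --> G] --> A i j.
Proof. by move=> fA; exact: cvg_comp fA (@coord_continuous _ m n i j A). Qed.

Lemma cvg_sum {R : realType} {T : Type} (G : set_system T) {FG : Filter G}
    (V : normedModType R) (I : Type) (s : seq I) (f : I -> T -> V) (a : I -> V) :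
  (forall i, f i @ G --> a i) ->
  \sum_(i <- s) f i t @[t --> G] --> \sum_(i <- s) a i.
Proof.
move=> fa; elim: s => [|i s IH].
  by under eq_cvg do rewrite big_nil; rewrite big_nil; exact: cvg_cst.
by under eq_cvg do rewrite big_cons; rewrite big_cons; exact: cvgD.
Qed.

(** * First-order chain rule by divided differences *)

Section ChainRule.
Context {R : realType} {n : nat}.
Implicit Types (V : set 'rV[R]_n) (f : 'rV[R]_n -> R) (h y : 'rV[R]_n).

Lemma derive_line_MVT f (i : 'I_n) y (a b : R) : a < b ->
  (forall t, a <= t <= b -> derivable f (t *: 'e_i + y) ('e_i : 'rV[R]_n)) ->
  exists2 c, a <= c <= b & f (b *: 'e_i + y) - f (a *: 'e_i + y) =
    'D_('e_i : 'rV[R]_n) f (c *: 'e_i + y) * (b - a).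
Proof.
move=> ab df; pose phi (t : R) : R := f (t *: 'e_i + y).
(* The difference quotients of the restriction [phi] are the directional ones of [f], so the
   one-variable mean value theorem can be applied to [phi]. *)
have growth t : (fun h : R => h^-1 *: ((phi \o shift t) (h *: 1) - phi t)) =
   (fun h : R => h^-1 *: ((f \o shift (t *: 'e_i + y)) (h *: 'e_i) -
      f (t *: 'e_i + y))).
  by apply/funext => h; rewrite /phi /shift/= {1}[_ *: 1]mulr1 scalerDl addrA.
have dphi t : a <= t <= b ->
    is_derive t 1 phi ('D_('e_i : 'rV[R]_n) f (t *: 'e_i + y)).
  move=> /df dft; split; first by rewrite /derivable growth.
  by rewrite /derive growth.
have [||c cab ->] := @MVT R phi
    (fun t => 'D_('e_i : 'rV[R]_n) f (t *: 'e_i + y)) a b ab.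
- move=> t tab; apply: dphi; move: tab; rewrite in_itv/= => /andP[? ?].
  by rewrite !ltW.
- apply: derivable_within_continuous => t; rewrite in_itv/= => tab.
  by have [] := dphi _ tab.
by exists c => //; move: cab; rewrite in_itv/= => /andP[? ?]; rewrite !ltW.
Qed.

Let part (k : nat) h : 'rV[R]_n := \row_i (if (i < k)%N then h 0 i else 0).

Let partS (i : 'I_n) h : part i.+1 h = h 0 i *: 'e_i + part i h.
Proof.
apply/rowP => j; rewrite !mxE eqxx/= ltnS leq_eqVlt -val_eqE/=.
by case: ltngtP => [| |/val_inj ->]; rewrite ?(mulr0,mulr1,add0r,addr0)//=.
Qed.

(* Divided difference along the [i]-th edge of the path from [y] to [y + h]
   that changes one coordinate at a time (Caratheodory's form of
   differentiability). *)
Let slope f y (i : 'I_n) h : R :=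
  if h 0 i == 0 then 'D_('e_i : 'rV[R]_n) f y
  else (f (part i.+1 h + y) - f (part i h + y)) / h 0 i.

(** Telescoping along the path; an edge with [h 0 i = 0] is degenerate and contributes nothing,
    whatever the default value of [slope]. *)
Let slopeE f y h : f (h + y) - f y = \sum_i h 0 i * slope f y i h.
Proof.
transitivity (\sum_(i < n) (f (part i.+1 h + y) - f (part i h + y))).
  rewrite -(big_mkord xpredT (fun i => f (part i.+1 h + y) - f (part i h + y))).
  rewrite telescope_sumr//; congr (f (_ + _) - f _).
    by apply/rowP => j; rewrite mxE ltn_ord.
  by rewrite -[LHS]add0r; congr (_ + _); apply/rowP => j; rewrite !mxE.
apply: eq_bigr => i _; rewrite /slope; case: eqP => [h0|/eqP h0].
  by rewrite h0 mul0r partS h0 scale0r add0r subrr.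
by rewrite mulrCA divff// mulr1.
Qed.

(** By the mean value theorem each slope is the partial derivative at a point of the edge, and that
    point tends to [y]. The default value at [h 0 i = 0] is the limit itself. *)
Let slope_cvg V f y i : open V -> classC 1 V f -> V y ->
  slope f y i h @[h --> (0 : 'rV[R]_n)] --> 'D_('e_i : 'rV[R]_n) f y.
Proof.
move=> oV fC Vy; apply/(@cvgrPdist_lt _ _ _ (nbhs (0 : 'rV[R]_n))) => e e0.
have := classC_continuous (classC_derive fC i) Vy.
move=> /cvgrPdist_lt/(_ e e0).
move=> /(filterI (open_nbhs_nbhs (conj oV Vy))).
move=> /nbhs_ballP[r /= r0] rV.
near=> h; have hr : `|h| < r.
  near: h; apply/nbhs_ballP; exists r => //= h.
  by rewrite mx_norm_ball /ball_/= sub0r normrN.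
have hrj j : `|h 0 j| < r.
  apply: le_lt_trans hr; rewrite [leRHS]/Num.Def.normr/= mx_normrE.
  exact: (le_bigmax _ _ (0, j)).
have near_y t : `|t| < r -> ball y r (t *: 'e_i + (part i h + y)).
  move=> tr; split=> // a j; rewrite ord1 /ball/= !mxE eqxx/=.
  rewrite addrA opprD addrCA subrr addr0 normrN.
  rewrite -val_eqE/=; case: ltngtP => //=;
    by rewrite ?(mulr0,mulr1,add0r,addr0) ?normr0.
rewrite /slope; case: eqP => [_|/eqP h0]; first by rewrite subrr normr0.
have [c cab] : exists2 c, `|c| < r &
    f (h 0 i *: 'e_i + (part i h + y)) - f (part i h + y) =
    'D_('e_i : 'rV[R]_n) f (c *: 'e_i + (part i h + y)) * h 0 i; last first.
  rewrite partS -addrA => ->; rewrite mulfK//.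
  by have [_] := rV _ (near_y _ cab).
(* The mean value theorem needs ordered endpoints, hence the split on the sign of [h 0 i]. *)
have hi := hrj i; move: h0; rewrite neq_lt => /orP[h0|h0].
- have [|c /andP[c1 c2]] := @derive_line_MVT f i (part i h + y) (h 0 i) 0 h0.
    move=> t /andP[t1 t2]; apply: (classC_derivable fC).
    have tr : `|t| < r by rewrite ler0_norm//; rewrite ltr0_norm// in hi; lra.
    by have [] := rV _ (near_y t tr).
  rewrite scale0r add0r => E; exists c; last by lra.
  by rewrite ler0_norm//; rewrite ltr0_norm// in hi; lra.
- have [|c /andP[c1 c2]] := @derive_line_MVT f i (part i h + y) 0 (h 0 i) h0.
    move=> t /andP[t1 t2]; apply: (classC_derivable fC).
    have tr : `|t| < r by rewrite ger0_norm//; rewrite gtr0_norm// in hi; lra.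
    by have [] := rV _ (near_y t tr).
  rewrite scale0r add0r => E; exists c; last by lra.
  by rewrite ger0_norm//; rewrite gtr0_norm// in hi; lra.
Unshelve. all: by end_near. Qed.

(** By [slopeE] the difference quotient of the composite is a sum of slopes times quotients of the
    coordinates of [tau]. Derivability of [tau] along [v] suffices, since it already makes the
    increment of [tau] tend to [0]. *)
Lemma is_derive_comp_coord {W : normedModType R} V f (tau : W -> 'rV[R]_n)
    (z v : W) : open V -> classC 1 V f -> V (tau z) ->
  (forall i, derivable (fun w => tau w 0 i) z v) ->
  is_derive z v (f \o tau)
    (\sum_i 'D_('e_i : 'rV[R]_n) f (tau z) * 'D_v (fun w => tau w 0 i) z).
Proof.
move=> oV fC Vz dtau; set l := \sum_i _.
have shift0 : (fun h : R => h *: v + z) @ 0^' --> z.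
  rewrite -[in X in _ --> X](add0r z) -(scale0r v).
  apply: cvgD; last exact: cvg_cst.
  by apply: cvgZr_tmp; exact: cvg_within.
have incr0 : tau (h *: v + z) - tau z @[h --> 0^'] --> (0 : 'rV[R]_n).
  apply: cvg_mx => a i; rewrite ord1 mxE.
  have : (h : R) * (h^-1 *: (tau (h *: v + z) 0 i - tau z 0 i)) @[h --> 0^'] -->
      0 * 'D_v (fun w => tau w 0 i) z.
    by apply: cvgM; [exact: cvg_within|exact: dtau].
  rewrite mul0r; apply: cvg_trans; apply: near_eq_cvg; near=> h.
  have h0 : h != 0 by near: h; exact: nbhs_dnbhs_neq.
  by rewrite !mxE/= [h^-1 *: _]/(h^-1 * _) mulrA divff// mul1r.
have key : h^-1 *: ((f \o tau \o shift z) (h *: v) - (f \o tau) z) @[h --> 0^'] --> l.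
  have -> : (fun h : R => h^-1 *: ((f \o tau \o shift z) (h *: v) - (f \o tau) z)) =
     (fun h : R => \sum_i slope f (tau z) i (tau (h *: v + z) - tau z) *
        (h^-1 *: (tau (h *: v + z) 0 i - tau z 0 i))).
    apply/funext => h /=; rewrite -{1}[tau (_ + _)](subrK (tau z)) slopeE.
    rewrite [LHS]mulr_sumr; apply: eq_bigr => i _.
    by rewrite !mxE mulrA mulrC.
  apply: cvg_sum => i; apply: cvgM; last exact: dtau.
  by apply: (cvg_comp _ (slope f (tau z) i) incr0); exact: slope_cvg oV fC Vz.
split; first by apply/cvg_ex; exists l.
exact/cvg_lim.
Unshelve. all: by end_near. Qed.

End ChainRule.

(** * Gradients, Hessians and the second-order chain rule *)

Definition grad (R : realType) (n : nat) (f : 'rV[R]_n -> R) (y : 'rV[R]_n) :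
  'rV[R]_n := \row_i 'D_('e_i : 'rV[R]_n) f y.

Definition hess (R : realType) (n : nat) (f : 'rV[R]_n -> R) (y : 'rV[R]_n) :
  'M[R]_n := \matrix_(i, j)
  'D_('e_i : 'rV[R]_n) (fun z => 'D_('e_j : 'rV[R]_n) f z) y.

Definition jac (R : realType) (m n : nat) (tau : 'rV[R]_m -> 'rV[R]_n)
    (y : 'rV[R]_m) : 'M[R]_(n, m) :=
  \matrix_(k, i) 'D_('e_i : 'rV[R]_m) (fun z => tau z 0 k) y.

Lemma gradE (R : realType) (n : nat) (f : 'rV[R]_n -> R) y a i :
  grad f y a i = 'D_('e_i : 'rV[R]_n) f y.
Proof. by rewrite mxE. Qed.

Lemma hessE (R : realType) (n : nat) (f : 'rV[R]_n -> R) y i j :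
  hess f y i j = 'D_('e_i : 'rV[R]_n) (fun z => 'D_('e_j : 'rV[R]_n) f z) y.
Proof. by rewrite mxE. Qed.

(* The Hessian is left unsymmetrized, so that the second-order chain rule needs
   no appeal to the symmetry of second derivatives. *)
Local Notation prejet R n := (R^o * 'rV[R]_n * 'M[R]_n)%type.

Section GradHess.
Context {R : realType} {n : nat}.
Variables (W : set 'rV[R]_n) (oW : open W).
Implicit Types f g : 'rV[R]_n -> R.

Lemma eq_grad f g y : {in W, f =1 g} -> W y -> grad f y = grad g y.
Proof.
move=> fg Wy; apply/rowP => i; rewrite !gradE.
by apply: near_eq_derive; exact: near_eqfun_open fg Wy.
Qed.

Lemma eq_hess f g y : {in W, f =1 g} -> W y -> hess f y = hess g y.
Proof.
move=> fg Wy; apply/matrixP => i j; rewrite !hessE; apply: near_eq_derive.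
apply: filterS (open_nbhs_nbhs (conj oW Wy)) => z Wz.
by apply: near_eq_derive; exact: near_eqfun_open fg Wz.
Qed.

Lemma derive_linear_comb f g y (t : R) i :
  derivable f y ('e_i : 'rV[R]_n) -> derivable g y ('e_i : 'rV[R]_n) ->
  'D_('e_i : 'rV[R]_n) (fun z => t * f z + g z) y =
  t * 'D_('e_i : 'rV[R]_n) f y + 'D_('e_i : 'rV[R]_n) g y.
Proof.
move=> df dg.
rewrite (_ : (fun z => _) = t *: f + g)// deriveD// ?deriveZ//.
exact: derivableZ.
Qed.

Lemma grad_linear f g y (t : R) : classC 1 W f -> classC 1 W g -> W y ->
  grad (fun z => t * f z + g z) y = t *: grad f y + grad g y.
Proof.
move=> fC gC Wy; apply/rowP => i; rewrite gradE [RHS]mxE [X in X + _]mxE !gradE.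
exact: derive_linear_comb (classC_derivable fC Wy i) (classC_derivable gC Wy i).
Qed.

Lemma hess_linear f g y (t : R) : classC 2 W f -> classC 2 W g -> W y ->
  hess (fun z => t * f z + g z) y = t *: hess f y + hess g y.
Proof.
move=> fC gC Wy; apply/matrixP => i j.
rewrite hessE [RHS]mxE [X in X + _]mxE !hessE -derive_linear_comb.
- apply: near_eq_derive.
  apply: filterS (open_nbhs_nbhs (conj oW Wy)) => z Wz.
  exact: derive_linear_comb (classC_derivable (classCS fC) Wz j)
                            (classC_derivable (classCS gC) Wz j).
- exact: (classC_derivable (classC_derive fC j) Wy i).
- exact: (classC_derivable (classC_derive gC j) Wy i).
Qed.

End GradHess.

Section SecondOrderChainRule.
Context {R : realType} {m n : nat}.
Variables (V : set 'rV[R]_n) (W : set 'rV[R]_m) (f : 'rV[R]_n -> R)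
  (tau : 'rV[R]_m -> 'rV[R]_n).
Hypotheses (oV : open V) (oW : open W) (tauW : forall y, W y -> V (tau y)).
Hypotheses (fC : classC 2 V f) (tC : forall k, classC 2 W (fun y => tau y 0 k)).

Lemma is_derive_comp1 (g : 'rV[R]_n -> R) y i : classC 1 V g -> W y ->
  is_derive y ('e_i : 'rV[R]_m) (g \o tau)
    (\sum_k 'D_('e_k : 'rV[R]_n) g (tau y) * jac tau y k i).
Proof.
move=> gC Wy; under eq_bigr do rewrite mxE.
apply: (is_derive_comp_coord oV gC (tauW Wy)) => k.
exact: (classC_derivable (tC k) Wy i).
Qed.

Lemma grad_comp y : W y -> grad (f \o tau) y = grad f (tau y) *m jac tau y.
Proof.
move=> Wy; apply/rowP => i; rewrite !mxE.
have [_ ->] := is_derive_comp1 i (classCS fC) Wy.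
by apply: eq_bigr => k _; rewrite !mxE.
Qed.

(** The first-order formula is differentiated by the product rule: the factors [dg l \o tau] give
    the congruence term, the factors [dt l] give the Hessians of the coordinates of [tau]. *)
Lemma hess_comp y : W y -> hess (f \o tau) y =
  (jac tau y)^T *m hess f (tau y) *m jac tau y +
  \sum_k grad f (tau y) 0 k *: hess (fun z => tau z 0 k) y.
Proof.
move=> Wy; apply/matrixP => i j; rewrite 2!mxE summxE.
pose dg l : 'rV[R]_n -> R := fun z => 'D_('e_l : 'rV[R]_n) f z.
pose dt l : 'rV[R]_m -> R := fun z => 'D_('e_j : 'rV[R]_m) (fun z => tau z 0 l) z.
(* To be differentiated again, the first-order formula must hold on a neighbourhood of [y]. *)
have near_dj : \forall z \near y, (\sum_l (dg l \o tau) * dt l) z =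
    'D_('e_j : 'rV[R]_m) (f \o tau) z.
  apply: filterS (open_nbhs_nbhs (conj oW Wy)) => z Wz.
  have [_ ->] := is_derive_comp1 j (classCS fC) Wz.
  by rewrite fct_sumE; apply: eq_bigr => l _; rewrite mxE.
have dl l : is_derive y ('e_i : 'rV[R]_m) ((dg l \o tau) * dt l)
   ((\sum_k 'D_('e_k : 'rV[R]_n) (dg l) (tau y) * jac tau y k i) * dt l y
    + dg l (tau y) * 'D_('e_i : 'rV[R]_m) (dt l) y).
  have d1 := is_derive_comp1 i (classC_derive fC l) Wy.
  have d2 : is_derive y ('e_i : 'rV[R]_m) (dt l) ('D_('e_i : 'rV[R]_m) (dt l) y).
    by apply: derivableP; exact: (classC_derivable (classC_derive (tC l) j) Wy i).
  apply: is_derive_eq; rewrite addrC; congr (_ + _).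
  exact: mulrC.
have [_ E] := near_eq_is_derive near_dj (is_derive_sum dl).
rewrite E big_split/=; congr (_ + _).
  rewrite [RHS]mxE; apply: eq_bigr => l _; rewrite !mxE; congr (_ * _).
  by apply: eq_bigr => k _; rewrite !mxE mulrC.
by apply: eq_bigr => l _; rewrite !mxE.
Qed.

End SecondOrderChainRule.

(** * Quadratic polynomials and their derivatives *)

Section QuadraticPolynomial.
Context {R : realType} {n : nat}.

Definition quadpoly (b : prejet R n) (h : 'rV[R]_n) : R :=
  b.1.1 + (b.1.2 *m h^T) 0 0 + 2^-1 * quad b.2 h.

Lemma quadpolyE b h : quadpoly b h = b.1.1 + \sum_k b.1.2 0 k * h 0 k
  + 2^-1 * \sum_k \sum_l b.2 k l * (h 0 k * h 0 l).
Proof.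
rewrite /quadpoly /quad !mxE; congr (_ + _ + _ * _).
  by apply: eq_bigr => k _; rewrite mxE.
rewrite exchange_big/=; apply: eq_bigr => k _; rewrite !mxE mulr_suml.
by apply: eq_bigr => l _; ring.
Qed.

Lemma is_derive_coord (y v : 'rV[R]_n) k :
  is_derive y v (fun z : 'rV[R]_n => z 0 k : R) (v 0 k).
Proof.
have /derivable_mxP dk := @derivable_id R ('rV[R]_n) y v.
split; first exact: dk.
have := derive_mx (@derivable_id R ('rV[R]_n) y v).
by rewrite derive_id => /rowP/(_ k); rewrite mxE => ->.
Qed.

Lemma derive_affine_sum (a : R) (w : 'I_n -> R) (y y0 : 'rV[R]_n) (i : 'I_n) :
  is_derive y ('e_i : 'rV[R]_n)
    (fun z => a + \sum_k w k * ((z - y0) 0 k)) (w i).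
Proof.
have dk k : is_derive y ('e_i : 'rV[R]_n) (fun z => w k * ((z - y0) 0 k))
    (w k * (i == k)%:R).
  have -> : (fun z : 'rV[R]_n => w k * ((z - y0) 0 k)) =
      (w k *: ((fun z : 'rV[R]_n => z 0 k : R) - cst (y0 0 k))).
    by apply/funext => z; rewrite !mxE.
  have d1 := is_derive_coord y ('e_i : 'rV[R]_n) k.
  by apply: is_derive_eq; rewrite subr0 mxE eqxx/= eq_sym.
have -> : (fun z => a + \sum_k w k * ((z - y0) 0 k)) =
   cst a + \sum_k (fun z => w k * ((z - y0) 0 k)).
  by apply/funext => z; rewrite -[RHS]/(_ + _) fct_sumE.
have ds := is_derive_sum dk.
apply: is_derive_eq; rewrite add0r (bigD1 i)//= eqxx mulr1 big1 ?addr0// => k ki.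
by rewrite eq_sym (negbTE ki) mulr0.
Qed.

(** The matrix [b.2] may fail to be symmetric, so its symmetric part appears. *)
Lemma derive_quadpoly b (y y0 : 'rV[R]_n) (i : 'I_n) :
  'D_('e_i : 'rV[R]_n) (fun z => quadpoly b (z - y0)) y =
  b.1.2 0 i + \sum_k (2^-1 * (b.2 i k + b.2 k i)) * (y - y0) 0 k.
Proof.
have dk k : is_derive y ('e_i : 'rV[R]_n) (fun z => (z - y0) 0 k) (i == k)%:R.
  have -> : (fun z : 'rV[R]_n => ((z - y0) 0 k)) =
      ((fun z : 'rV[R]_n => z 0 k : R) - cst (y0 0 k)).
    by apply/funext => z; rewrite !mxE.
  have d1 := is_derive_coord y ('e_i : 'rV[R]_n) k.
  by apply: is_derive_eq; rewrite subr0 mxE eqxx/= eq_sym.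
have dkl k l : is_derive y ('e_i : 'rV[R]_n)
    (b.2 k l *: ((fun z : 'rV[R]_n => (z - y0) 0 k) * (fun z => (z - y0) 0 l)))
    (b.2 k l * ((y - y0) 0 k * (i == l)%:R + (y - y0) 0 l * (i == k)%:R)).
  have d1 := dk k; have d2 := dk l; exact: is_derive_eq.
have dkk k := is_derive_sum (dkl k).
have dd := is_derive_sum dkk.
have d1 := derive_affine_sum b.1.1 (fun k => b.1.2 0 k) y y0 i.
rewrite (_ : (fun z => _) = (fun z => b.1.1 + \sum_k b.1.2 0 k * ((z - y0) 0 k))
  + 2^-1 *: (\sum_k \sum_l (b.2 k l *:
      ((fun z : 'rV[R]_n => (z - y0) 0 k) * (fun z => (z - y0) 0 l)))));
  last first.
  apply/funext => z; rewrite quadpolyE -[RHS]/(_ + _); congr (_ + _ * _).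
  rewrite fct_sumE; apply: eq_bigr => k _.
  by rewrite fct_sumE; apply: eq_bigr => l _.
have [_ ->] := is_deriveD d1 (is_deriveZ 2^-1 dd).
congr (_ + _).
rewrite [LHS]mulr_sumr.
under eq_bigr do rewrite mulr_sumr.
transitivity (\sum_k \sum_l 2^-1 * (b.2 k l * ((y - y0) 0 k * (i == l)%:R)) +
   \sum_k \sum_l 2^-1 * (b.2 k l * ((y - y0) 0 l * (i == k)%:R))).
  rewrite -big_split/=; apply: eq_bigr => k _.
  by rewrite -big_split/=; apply: eq_bigr => l _; rewrite !mulrDr.
have Ea (F : 'I_n -> R) : \sum_k F k * (i == k)%:R = F i.
  rewrite (bigD1 i)//= eqxx mulr1 big1 ?addr0// => k ki.
  by rewrite eq_sym (negbTE ki) mulr0.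
(* The two halves of the product rule pick out row [i] and column [i] of [b.2]; exchanging the sums
   in one of them lets both be indexed by [k]. *)
rewrite addrC [X in X + _]exchange_big/= -big_split/=; apply: eq_bigr => k _.
rewrite mulrDr mulrDl.
transitivity (2^-1 * (b.2 i k * (y - y0) 0 k) + 2^-1 * (b.2 k i * (y - y0) 0 k)).
  rewrite -(Ea (fun l => 2^-1 * (b.2 l k * (y - y0) 0 k))).
  rewrite -(Ea (fun l => 2^-1 * (b.2 k l * (y - y0) 0 k))).
  by congr (_ + _); apply: eq_bigr => l _; ring.
by rewrite !mulrA.
Qed.

Lemma grad_quadpoly b (y0 : 'rV[R]_n) :
  grad (fun z => quadpoly b (z - y0)) y0 = b.1.2.
Proof.
apply/rowP => i; rewrite mxE derive_quadpoly subrr big1 ?addr0// => k _.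
by rewrite !mxE mulr0.
Qed.

Lemma hess_quadpoly b (y0 : 'rV[R]_n) :
  hess (fun z => quadpoly b (z - y0)) y0 = 2^-1 *: (b.2 + b.2^T).
Proof.
apply/matrixP => i j; rewrite mxE.
under eq_fun do rewrite derive_quadpoly.
have [_ ->] := derive_affine_sum (b.1.2 0 j)
  (fun k => 2^-1 * (b.2 j k + b.2 k j)) y0 y0 i.
by rewrite !mxE addrC.
Qed.

End QuadraticPolynomial.

(** * Unsymmetrized jets and their change of coordinates *)

Section Prejet.
Context {R : realType} {n : nat}.

(** Projection of prejets onto jets; its kernel consists of the antisymmetric Hessians, and
    [unsymjet] is a section of it. *)
Definition symjet (b : prejet R n) : jetval R n :=
  (b.1.1, b.1.2, symmetrize b.2).

Definition unsymjet (j : jetval R n) : prejet R n :=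
  (j.1.1, j.1.2, symm_mx j.2).

Lemma symmP (A B : symm R n) : symm_mx A = symm_mx B -> A = B.
Proof. by move=> AB; apply: val_inj. Qed.

Lemma symm_tr (A : symm R n) : (symm_mx A)^T = symm_mx A.
Proof. by apply/eqP; have := symm_mxP A; rewrite inE. Qed.

Lemma unsymjetK (j : jetval R n) : symjet (unsymjet j) = j.
Proof.
case: j => [[r p] A]; congr (_, _, _); apply: symmP => /=.
by rewrite symm_tr; apply/matrixP => i j; rewrite !mxE; field.
Qed.

Lemma symjet_linear (t : R) (a b : prejet R n) :
  symjet (t *: a + b) = t *: symjet a + symjet b.
Proof.
congr (_, _, _); apply: symmP => /=.
by apply/matrixP => i j; rewrite !mxE; ring.
Qed.

Lemma symjet_eqP (a b : prejet R n) : symjet a = symjet b <->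
  a.1 = b.1 /\ a.2 + a.2^T = b.2 + b.2^T.
Proof.
case: a b => [[r p] A] [[r' p'] A']; split => [|[/= [-> ->] E]].
  move=> [-> -> E]; split => //=; move: E => /(congr1 ( *:%R 2)).
  by rewrite !scalerA divff ?pnatr_eq0// !scale1r.
by congr (_, _, _); apply: symmP => /=; rewrite E.
Qed.

(** The second-order chain rule read as a map on prejets: pullback along [tau] at [y]. *)
Definition transjet (tau : 'rV[R]_n -> 'rV[R]_n) (y : 'rV[R]_n)
    (b : prejet R n) : prejet R n :=
  (b.1.1, b.1.2 *m jac tau y, (jac tau y)^T *m b.2 *m jac tau y +
     \sum_k b.1.2 0 k *: hess (fun z => tau z 0 k) y).

Lemma transjet_linear tau y (t : R) (a b : prejet R n) :
  transjet tau y (t *: a + b) = t *: transjet tau y a + transjet tau y b.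
Proof.
congr (_, _, _) => /=; first by rewrite mulmxDl scalemxAl.
rewrite mulmxDr mulmxDl -scalemxAr -scalemxAl scalerDr scaler_sumr.
rewrite addrACA -big_split/=; congr (_ + _); apply: eq_bigr => k _.
by rewrite !mxE scalerDl scalerA.
Qed.

(** Congruence by the Jacobian commutes with transposition, and the added Hessians of [tau] are
    weighted by the gradient part alone, so [transjet] descends to jets. *)
Lemma symjet_trans tau y (a b : prejet R n) : symjet a = symjet b ->
  symjet (transjet tau y a) = symjet (transjet tau y b).
Proof.
case: a b => [[r p] A] [[r' p'] A'] /symjet_eqP[/= [-> ->] E].
apply/symjet_eqP; split => //=; set H := \sum_k _; set D := jac _ _.
rewrite !linearD/= !trmx_mul !trmxK !mulmxA addrACA [RHS]addrACA; congr (_ + _).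
by rewrite -!mulmxA -!mulmxDr -!mulmxDl E.
Qed.

End Prejet.

(** * Jets of functions in the charts of a manifold *)

Section Jets.
Context {R : realType} {n : nat} {X : manifold R n}.
Implicit Types (c d : chart R n X) (x : X) (u : X -> R).

Lemma chart_at_atlas x : atlas (chart_at x).
Proof. by rewrite /chart_at; case: cid => c []. Qed.

Lemma chart_at_dom x : cdom (chart_at x) x.
Proof. by rewrite /chart_at; case: cid => c []. Qed.

Definition prejet_in c u x : prejet R n :=
  (u x, grad (u \o cinv c) (cfun c x), hess (u \o cinv c) (cfun c x)).

Lemma jet_inE c u x : jet_in c u x = symjet (prejet_in c u x).
Proof. by []. Qed.

Lemma chart_image_open c (A : set X) : open A -> open (cfun c @` (A `&` cdom c)).
Proof.
move=> oA.
have -> : cfun c @` (A `&` cdom c) =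
    (cfun c @` cdom c) `&` cinv c @^-1` A.
  apply/seteqP; split => [y [x [Ax cx] <-]|y [[x cx <-]]].
    by split; [exists x|rewrite /preimage/= cfunK].
  by rewrite /preimage/= cfunK// => Ax; exists x.
rewrite openE => y [cy Ay]; apply: filterI.
  by apply: open_nbhs_nbhs; split => //; exact: cimg_open.
by apply: cinv_continuous => //; exact: open_nbhs_nbhs.
Qed.

Arguments chart_image_open c {A} _.

Lemma chart_nbhs c x (A : set 'rV[R]_n) : cdom c x -> nbhs (cfun c x) A ->
  \forall z \near x, A (cfun c z).
Proof. by move=> cx; exact: cfun_continuous. Qed.

Lemma near_cdom c x : cdom c x -> \forall z \near x, cdom c z.
Proof. by move=> cx; apply: open_nbhs_nbhs; split => //; exact: cdom_open. Qed.

(** Coordinate change from [d] to [c]; pullback along it turns prejets in [c] into prejets in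
    [d]. *)
Definition transition c d (y : 'rV[R]_n) : 'rV[R]_n := cfun c (cinv d y).

Lemma transition_classC c d k (U : set X) (i : 'I_n) : atlas c -> atlas d ->
  U `<=` cdom c ->
  classC k (cfun d @` (U `&` cdom d)) (fun y => transition c d y 0 i).
Proof.
move=> ac ad Uc; apply: classC_subset (atlas_smooth ad ac k i).
by apply: image_subset => x [/Uc].
Qed.

(** Near the point, [u \o cinv d] is [u \o cinv c] composed with the transition map, so both chain
    rules apply. *)
Lemma prejet_trans c d u x : atlas c -> atlas d -> cdom c x -> cdom d x ->
  C2_near x u ->
  prejet_in d u x = transjet (transition c d) (cfun d x) (prejet_in c u x).
Proof.
move=> ac ad cx dx [U [oU Ux uC]].
have oUc : open (U `&` cdom c) by apply: openI => //; exact: cdom_open.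
have oV := chart_image_open c oU.
have oW := chart_image_open d oUc.
set V := cfun c @` _ in oV; set W := cfun d @` _ in oW.
have tW y : W y -> V (transition c d y).
  by move=> [z [[Uz cz] dz] <-]; exists z; rewrite /transition ?cfunK.
have tC k : classC 2 W (fun y => transition c d y 0 k).
  by apply: transition_classC => // z [].
have Wx : W (cfun d x) by exists x.
have EW : {in W, (u \o cinv c) \o transition c d =1 u \o cinv d}.
  by move=> y; rewrite inE => -[z [[Uz cz] dz] <-]; rewrite /transition/= !cfunK.
have tx : transition c d (cfun d x) = cfun c x by rewrite /transition cfunK.
have fC := uC c ac.
rewrite /prejet_in -(eq_grad oW EW Wx) -(eq_hess oW EW Wx).
by rewrite (grad_comp oV tW fC tC Wx) (hess_comp oV oW tW fC tC Wx) tx.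
Qed.

Lemma C2_near_continuous u x : C2_near x u -> {for x, continuous u}.
Proof.
move=> [U [oU Ux uC]]; set c := chart_at x.
have cx : cdom c x := chart_at_dom x.
have Vx : (cfun c @` (U `&` cdom c)) (cfun c x) by exists x.
have := classC_continuous (uC c (chart_at_atlas x)) Vx.
rewrite /prop_for /continuous_at/= cfunK// => uc.
have := cvg_comp _ _ (cfun_continuous cx) uc.
apply: cvg_trans; apply: near_eq_cvg.
by apply: filterS (near_cdom cx) => z cz /=; rewrite cfunK.
Qed.

Lemma C2_nearD u v x : C2_near x u -> C2_near x v ->
  C2_near x (fun z => u z + v z).
Proof.
move=> [U [oU Ux uC]] [V [oV Vx vC]]; exists (U `&` V); split; [exact: openI|by []|move=> c ac].
have oW := chart_image_open c (openI oU oV).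
apply: (classCD oW).
  apply: classC_subset (uC _ ac); apply: image_subset => z.
  by move=> [[? ?] ?].
apply: classC_subset (vC _ ac); apply: image_subset => z.
by move=> [[? ?] ?].
Qed.

Lemma C2_near_cst x (a : R) : C2_near x (cst a).
Proof. by exists setT; split; [exact: openT|by []|move=> c ac; exact: classC_cst]. Qed.

Lemma C2_nearZ u x (a : R) : C2_near x u -> C2_near x (fun z => a * u z).
Proof.
move=> [U [oU Ux uC]]; exists U; split; [exact: oU|exact: Ux|move=> c ac].
apply: (@classCZ _ _ _ _ a (u \o cinv c)); last exact: uC.
exact: chart_image_open.
Qed.

Lemma prejet_linear c u v x (t : R) : atlas c -> cdom c x ->
  C2_near x u -> C2_near x v ->
  prejet_in c (fun z => t * u z + v z) x =
  t *: prejet_in c u x + prejet_in c v x.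
Proof.
move=> ac cx [U [oU Ux uC]] [V [oV Vx vC]].
have oW := chart_image_open c (openI oU oV).
set W := cfun c @` _ in oW.
have Wx : W (cfun c x) by exists x.
have {}uC : classC 2 W (u \o cinv c).
  apply: classC_subset (uC _ ac); apply: image_subset => z.
  by move=> [[? ?] ?].
have {}vC : classC 2 W (v \o cinv c).
  apply: classC_subset (vC _ ac); apply: image_subset => z.
  by move=> [[? ?] ?].
rewrite /prejet_in (grad_linear t (classCS uC) (classCS vC) Wx).
by rewrite (hess_linear oW t uC vC Wx).
Qed.

(** The analogue of [jet_rep] in an arbitrary chart: a C^2 function with prescribed jet at [x]. *)
Definition jetfun c (b : prejet R n) x : X -> R :=
  fun z => quadpoly b (cfun c z - cfun c x).

Lemma jet_repE (J : J2 X) :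
  jet_rep J = jetfun (chart_at (jpos J)) (unsymjet (jcomp J)) (jpos J).
Proof. by case: J => x [[r p] A]. Qed.

Lemma jetfun_C2_on c b x : atlas c -> C2_on (cdom c) (jetfun c b x).
Proof.
move=> ac d ad.
have oW := chart_image_open d (@cdom_open _ _ _ c).
set W := cfun d @` _ in oW *.
have lC k : classC 2 W (fun y => (transition c d y - cfun c x) 0 k).
  under eq_fun do rewrite mxE.
  apply: (classCD oW); last exact: classC_cst.
  exact: transition_classC.
rewrite (_ : _ \o _ = fun y => b.1.1 +
    \sum_k b.1.2 0 k * (transition c d y - cfun c x) 0 k
    + 2^-1 * \sum_k \sum_l b.2 k l *
       ((transition c d y - cfun c x) 0 k * (transition c d y - cfun c x) 0 l)).
  apply: (classCD oW).
    apply: (classCD oW); first exact: classC_cst.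
    by apply: (classC_sum _ oW) => k; exact: (classCZ _ oW).
  apply: (classCZ _ oW).
  apply: (classC_sum _ oW) => k; apply: (classC_sum _ oW) => l.
  by apply: (classCZ _ oW); exact: (classCM oW).
by apply/funext => y; rewrite /jetfun/= quadpolyE.
Qed.

Lemma jetfun_C2_near c b x z : atlas c -> cdom c z -> C2_near z (jetfun c b x).
Proof.
move=> ac cz; exists (cdom c); split; [exact: cdom_open|exact: cz|].
exact: jetfun_C2_on.
Qed.

Lemma prejet_jetfun c b x : cdom c x ->
  symjet (prejet_in c (jetfun c b x) x) = symjet b.
Proof.
move=> cx; set y0 := cfun c x.
have oV := @cimg_open _ _ _ c.
have Vx : (cfun c @` cdom c) y0 by exists x.
have E : {in cfun c @` cdom c, jetfun c b x \o cinv c =1 fun z => quadpoly b (z - y0)}.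
  by move=> y; rewrite inE => -[z cz <-]; rewrite /jetfun/= cfunK.
apply/symjet_eqP; rewrite /prejet_in -/y0.
rewrite (eq_grad oV E Vx) (eq_hess oV E Vx) grad_quadpoly hess_quadpoly/=.
split.
  rewrite /jetfun -/y0 subrr quadpolyE !big1 ?mulr0 ?addr0//.
  - by case: (b.1).
  - by move=> k _; rewrite big1// => l _; rewrite mxE mul0r mulr0.
  - by move=> k _; rewrite mxE mulr0.
by apply/matrixP => i j; rewrite !mxE; field.
Qed.

(** The jet at [x] whose prejet in [c] is [b], transported to the fibre coordinates of [chart_at x].
    As [chart_at x] may jump with [x], continuity of jets is expressed through a fixed [c]. *)
Definition chart_jet c x (b : prejet R n) : J2 X :=
  Jet x (symjet (transjet (transition c (chart_at x)) (cfun (chart_at x) x) b)).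

Lemma jet2_chart_jet c u x : atlas c -> cdom c x -> C2_near x u ->
  jet2 u x = chart_jet c x (prejet_in c u x).
Proof.
move=> ac cx uC; rewrite /jet2 /chart_jet jet_inE (@prejet_trans c)//.
- exact: chart_at_atlas.
- exact: chart_at_dom.
Qed.

Lemma chart_jet_jetfun c x b : atlas c -> cdom c x ->
  chart_jet c x b = jet2 (jetfun c b x) x.
Proof.
move=> ac cx; rewrite (jet2_chart_jet ac cx); last exact: jetfun_C2_near.
by congr Jet; apply: symjet_trans; rewrite prejet_jetfun.
Qed.

Lemma chart_jet_symjet c x a b : symjet a = symjet b -> chart_jet c x a = chart_jet c x b.
Proof. by move=> ab; congr Jet; exact: symjet_trans. Qed.

Lemma chart_jet_surj c (J : J2 X) : atlas c -> cdom c (jpos J) ->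
  exists b, J = chart_jet c (jpos J) (unsymjet b).
Proof.
move=> ac cx; set x := jpos J.
(* The witness is read off in [c] from the polynomial representing [J]. *)
exists (jet_in c (jet_rep J) x); rewrite jet_inE.
rewrite (@chart_jet_symjet _ _ _ (prejet_in c (jet_rep J) x)) ?unsymjetK//.
rewrite jet_repE -jet2_chart_jet//; last first.
  by apply: jetfun_C2_near; [exact: chart_at_atlas|exact: chart_at_dom].
rewrite /jet2 jet_inE prejet_jetfun ?unsymjetK; last exact: chart_at_dom.
by rewrite /x; case: J {cx x}.
Qed.

Lemma chart_jet_linear c x (t : R) a b : jcomp (chart_jet c x (t *: a + b)) =
  t *: jcomp (chart_jet c x a) + jcomp (chart_jet c x b).
Proof. by rewrite /= transjet_linear symjet_linear. Qed.

(** [jet_coord] evaluates the polynomial representative of the jet, which has the same jet as [u] in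
    [chart_at x]; by [symjet_trans] the two agree in [d] as well. *)
Lemma jet_coord_jet2 d u x : atlas d -> cdom d x -> C2_near x u ->
  jet_coord d (jet2 u x) = (cfun d x, jet_in d u x).
Proof.
move=> ad dx uC; pose c := chart_at x.
have ac : atlas c := chart_at_atlas x.
have cx : cdom c x := chart_at_dom x.
pose w := jetfun c (unsymjet (jet_in c u x)) x.
have wC : C2_near x w := jetfun_C2_near _ x ac cx.
have wE : jet_rep (jet2 u x) = w := jet_repE _.
have E : jet_in d w x = jet_in d u x.
  rewrite !jet_inE (prejet_trans ac ad cx dx wC) (prejet_trans ac ad cx dx uC).
  have h : symjet (prejet_in c w x) = symjet (prejet_in c u x) :=
    etrans (prejet_jetfun _ cx) (unsymjetK _).
  exact: symjet_trans h.
by rewrite /jet_coord wE -E.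
Qed.

Lemma jet_coord_chart_jet c d x b : atlas c -> atlas d -> cdom c x -> cdom d x ->
  jet_coord d (chart_jet c x b) =
  (cfun d x, symjet (transjet (transition c d) (cfun d x) b)).
Proof.
move=> ac ad cx dx; have fC := jetfun_C2_near b x ac cx.
rewrite (chart_jet_jetfun b ac cx) (jet_coord_jet2 ad dx fC) jet_inE.
rewrite (prejet_trans ac ad cx dx fC).
by rewrite (symjet_trans _ _ (prejet_jetfun b cx)).
Qed.

End Jets.

(** * Convergence in jet spaces and in the jet bundle *)

Section JetTopology.
Context {R : realType} {n : nat} {T : Type} (G : set_system T) {FG : Filter G}.

Lemma cvg_prejet (a : T -> R) (p : T -> 'rV[R]_n) (A : T -> 'M[R]_n) a0 p0 A0 :
  a @ G --> a0 -> p @ G --> p0 -> A @ G --> A0 ->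
  ((a t, p t, A t) : prejet R n) @[t --> G] --> ((a0, p0, A0) : prejet R n).
Proof. by move=> ac pc Ac; exact: cvg_pair (cvg_pair ac pc) Ac. Qed.

Lemma prejet_cvg (b : T -> prejet R n) (b0 : prejet R n) : b @ G --> b0 ->
  [/\ (b t).1.1 @[t --> G] --> b0.1.1,
      (b t).1.2 @[t --> G] --> b0.1.2 & (b t).2 @[t --> G] --> b0.2].
Proof.
move=> bc.
have b1 : (b t).1 @[t --> G] --> b0.1 by apply: cvg_comp bc _; exact: cvg_fst.
have b2 : (b t).2 @[t --> G] --> b0.2 by apply: cvg_comp bc _; exact: cvg_snd.
split=> //; [apply: cvg_comp b1 _; exact: cvg_fst|].
by apply: cvg_comp b1 _; exact: cvg_snd.
Qed.

Lemma cvg_symm (A : T -> symm R n) (A0 : symm R n) :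
  symm_mx (A t) @[t --> G] --> symm_mx A0 -> A @ G --> A0.
Proof.
move=> Ac B [C [[D oD <-] DA DB]].
have GD : G ((fun t => symm_mx (A t)) @^-1` D) := Ac D (open_nbhs_nbhs (conj oD DA)).
by change (G (A @^-1` B)); apply: filterS GD => t; exact: DB.
Qed.

Lemma cvg_mulmx m k l (A : T -> 'M[R]_(m, k)) (B : T -> 'M[R]_(k, l))
    (A0 : 'M[R]_(m, k)) (B0 : 'M[R]_(k, l)) :
  A @ G --> A0 -> B @ G --> B0 -> A t *m B t @[t --> G] --> A0 *m B0.
Proof.
move=> Ac Bc; apply: cvg_mx => i j; rewrite mxE.
under eq_cvg do rewrite mxE.
by apply: cvg_sum => h; apply: cvgM; exact: cvg_coord.
Qed.

Lemma cvg_trmx m k (A : T -> 'M[R]_(m, k)) (A0 : 'M[R]_(m, k)) :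
  A @ G --> A0 -> (A t)^T @[t --> G] --> A0^T.
Proof.
move=> Ac; apply: cvg_mx => i j; rewrite mxE.
by under eq_cvg do rewrite mxE; exact: cvg_coord.
Qed.

Lemma cvg_symjet (b : T -> prejet R n) (b0 : prejet R n) :
  b @ G --> b0 -> symjet (b t) @[t --> G] --> symjet b0.
Proof.
move=> /prejet_cvg[b1 b2 b3].
have s3 : symmetrize (b t).2 @[t --> G] --> symmetrize b0.2.
  apply: cvg_symm => /=.
  apply: cvg_mx => i j; rewrite !mxE; under eq_cvg do rewrite !mxE.
  apply: cvgM; first exact: cvg_cst.
  by apply: cvgD; exact: cvg_coord.
exact: cvg_pair (cvg_pair b1 b2) s3.
Qed.

(** [transjet] is polynomial in the prejet and in the first and second derivatives of [tau], which
    are continuous at [y0]. *)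
Lemma cvg_transjet (tau : 'rV[R]_n -> 'rV[R]_n) (W : set 'rV[R]_n)
    (y : T -> 'rV[R]_n) (y0 : 'rV[R]_n) (b : T -> prejet R n)
    (b0 : prejet R n) :
  (forall k, classC 2 W (fun z => tau z 0 k)) -> W y0 ->
  y @ G --> y0 -> b @ G --> b0 ->
  transjet tau (y t) (b t) @[t --> G] --> transjet tau y0 b0.
Proof.
move=> tC Wy0 yc /prejet_cvg[b1 b2 b3].
have jc : jac tau (y t) @[t --> G] --> jac tau y0.
  apply: cvg_matrix => i j.
  exact: (cvg_comp _ _ yc (classC_continuous (classC_derive (tC i) j) Wy0)).
have hc k : hess (fun z => tau z 0 k) (y t) @[t --> G] -->
    hess (fun z => tau z 0 k) y0.
  apply: cvg_matrix => i j.
  exact: (cvg_comp _ _ yc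
    (classC_continuous (classC_derive (classC_derive (tC k) j) i) Wy0)).
have c2 := cvg_mulmx b2 jc.
have c3 := cvg_mulmx (cvg_mulmx (cvg_trmx jc) b3) jc.
have c4 : (\sum_k (b t).1.2 0 k *: hess (fun z => tau z 0 k) (y t)) @[t --> G] -->
    \sum_k b0.1.2 0 k *: hess (fun z => tau z 0 k) y0.
  by apply: cvg_sum => k; apply: cvgZ (hc k); exact: cvg_coord.
exact: cvg_prejet b1 c2 (cvgD c3 c4).
Qed.

(** Every neighbourhood contains a finite intersection of subbasic sets around the point, and
    filters are closed under finite intersections. *)
Lemma cvg_J2 {X : manifold R n} (f : T -> J2 X) (J : J2 X) :
  (forall W, jet_subbase W -> W J -> \forall t \near G, W (f t)) -> f @ G --> J.
Proof.
move=> fJ A; rewrite nbhsE => -[B [[D' sD' <-] [C D'C CJ]] BA].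
have [E sE CE] := sD' C D'C.
have GE := @filter_bigI T _ E (fun W => f @^-1` W) G FG.
change (G (f @^-1` A)); apply: filterS (GE _) => [t tE|W WE].
  by apply: BA; exists C => //; rewrite -[isBaseTopological.b C]/C -CE.
apply: fJ; first exact: set_mem (sE W WE).
by move: CJ; rewrite -CE; exact.
Qed.

Context {X : manifold R n}.
Implicit Types (c d : chart R n X) (x : X) (u : X -> R).

(** Read in a second chart [d], these jets are given by [transjet] for the fixed pair [c], [d]; the
    varying chart [chart_at] cancels. *)
Lemma cvg_chart_jet c (x : T -> X) (x0 : X) (b : T -> prejet R n)
    (b0 : prejet R n) :
  atlas c -> cdom c x0 -> x @ G --> x0 -> b @ G --> b0 ->
  chart_jet c (x t) (b t) @[t --> G] --> chart_jet c x0 b0.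
Proof.
move=> ac cx0 xc bc; apply: cvg_J2 => W [d [B [ad oB ->]]] [dx B0].
have {dx}dx0 : cdom d x0 := dx.
have := jet_coord_chart_jet b0 ac ad cx0 dx0.
move: (jet_coord d _) B0 => J B0 E; rewrite {J}E in B0.
have nc : \forall t \near G, cdom c (x t) by exact: xc (near_cdom cx0).
have nd : \forall t \near G, cdom d (x t) by exact: xc (near_cdom dx0).
have dc : cfun d (x t) @[t --> G] --> cfun d x0.
  exact: (cvg_comp _ _ xc (cfun_continuous dx0)).
have tc : transjet (transition c d) (cfun d (x t)) (b t) @[t --> G] -->
    transjet (transition c d) (cfun d x0) b0.
  have Wx0 : (cfun d @` (cdom c `&` cdom d)) (cfun d x0) by exists x0.
  apply: (@cvg_transjet _ (cfun d @` (cdom c `&` cdom d)) _ _ _ _ _ Wx0 dc bc).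
  by move=> k; exact: transition_classC.
have nB : G (fun t => B (cfun d (x t),
    symjet (transjet (transition c d) (cfun d (x t)) (b t)))).
  have : nbhs (cfun d x0, symjet (transjet (transition c d) (cfun d x0) b0)) B.
    exact: open_nbhs_nbhs.
  by apply: (cvg_pair dc (cvg_symjet tc)).
change (G (fun t => cdom d (x t) /\ B (jet_coord d (chart_jet c (x t) (b t))))).
apply: (@filterS T G FG _ _ _ (filterI nc (filterI nd nB))) => t [ct [dt Bt]].
split; first exact: dt.
by rewrite (jet_coord_chart_jet (b t) ac ad ct dt).
Qed.

End JetTopology.

(** * Continuity of jet sections and compactness of jet spheres *)

Section JetSections.
Context {R : realType} {n : nat} {X : manifold R n}.
Implicit Types (c d : chart R n X) (x : X) (u : X -> R).

Lemma cvg_prejet_in c u x0 : atlas c -> cdom c x0 -> C2_near x0 u ->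
  prejet_in c u x @[x --> x0] --> prejet_in c u x0.
Proof.
move=> ac cx0 uC0; have [U [oU Ux uC]] := uC0.
have Wx : (cfun c @` (U `&` cdom c)) (cfun c x0) by exists x0.
have cc := cfun_continuous cx0.
have fC := uC _ ac.
apply: cvg_prejet.
- exact: C2_near_continuous.
- apply: cvg_matrix => i j.
  exact: (cvg_comp _ _ cc (classC_continuous (classC_derive fC j) Wx)).
- apply: cvg_matrix => i j.
  exact: (cvg_comp _ _ cc (classC_continuous (classC_derive (classC_derive fC j) i) Wx)).
Qed.

Lemma jet_coord_chart_jet_self c x b : atlas c -> cdom c x ->
  jet_coord c (chart_jet c x b) = (cfun c x, symjet b).
Proof.
move=> ac cx; rewrite (chart_jet_jetfun b ac cx).
rewrite (jet_coord_jet2 ac cx (jetfun_C2_near b x ac cx)) jet_inE.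
by rewrite (prejet_jetfun b cx).
Qed.

Lemma chart_jet_inj c x a b : atlas c -> cdom c x ->
  chart_jet c x a = chart_jet c x b -> symjet a = symjet b.
Proof.
move=> ac cx E.
have := etrans (esym (jet_coord_chart_jet_self a ac cx))
  (etrans (congr1 (jet_coord c) E) (jet_coord_chart_jet_self b ac cx)).
exact: (congr1 snd).
Qed.

Lemma compact_prejet_cube (r : R) : compact
  [set b : prejet R n | [/\ `|b.1.1 : R| <= r, forall k, `|b.1.2 0 k| <= r &
                         forall i j, `|b.2 i j| <= r]].
Proof.
have seg : compact [set a : R | `|a| <= r].
  rewrite (_ : mkset _ = `[- r, r]%classic); first exact: segment_compact.
  by apply/seteqP; split=> a /=; rewrite in_itv/= ler_norml.
have Cr m : compact [set v : 'rV[R]_m | forall i, `|v 0 i| <= r].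
  exact: (@rV_compact R m (fun=> [set a : R | `|a| <= r])).
have CM : compact [set A : 'M[R]_n | forall i j, `|A i j| <= r].
  (* Flattening reduces matrices to row vectors, where a product of segments is compact. *)
  have -> : [set A : 'M[R]_n | forall i j, `|A i j| <= r] =
     (@vec_mx R n n) @` [set v : 'rV[R]_(n * n) | forall i, `|v 0 i| <= r].
    apply/seteqP; split=> [A Ar|_ [v vr <-] i j]; last by rewrite mxE.
    exists (mxvec A); last exact: mxvecK.
    by move=> k; case/mxvec_indexP: k => i j; rewrite mxvecE.
  apply: continuous_compact (Cr _); apply: continuous_subspaceT => v.
  apply: (@cvg_mx _ _ (nbhs v)) => i j; rewrite mxE; under eq_cvg do rewrite mxE.
  exact: coord_continuous.
have := compact_setX (compact_setX seg (Cr n)) CM.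
congr compact; apply/seteqP; split=> -[[a p] A] /=.
  by move=> [[]].
by move=> [].
Qed.

Lemma mx_coord_le m k (A : 'M[R]_(m, k)) i j : `|A i j| <= `|A|.
Proof.
rewrite [leRHS]/Num.Def.normr/= mx_normrE.
exact: (le_bigmax _ _ (i, j)).
Qed.

(** A closed subset of a cube. Symmetry is imposed because [chart_jet] kills antisymmetric Hessians,
    on which the metric has no positive lower bound. *)
Lemma compact_prejet_sphere (r : R) : compact
  [set b : prejet R n | `|b| = r /\ b.2^T = b.2].
Proof.
apply: (subclosed_compact _ (@compact_prejet_cube r)); last first.
  move=> [[a p] A] /= [br _]; rewrite -br; split.
  - by rewrite !prod_normE/= le_max le_max lexx.
  - move=> k; apply: le_trans (mx_coord_le _ _ _) _.
    by rewrite !prod_normE/= le_max le_max lexx orbT.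
  - move=> i j; apply: le_trans (mx_coord_le _ _ _) _.
    by rewrite !prod_normE/= le_max lexx orbT.
rewrite (_ : mkset _ = (fun b : prejet R n => `|b|) @^-1` [set r] `&`
   (fun b : prejet R n => `|b.2^T - b.2|) @^-1` [set 0]); last first.
  apply/seteqP; split=> b /= [->]; first by move=> ->; rewrite subrr normr0.
  by move=> /eqP; rewrite normr_eq0 subr_eq0 => /eqP.
apply: closedI; apply: preimage_closed; try exact: closed_eq.
  by move=> b _; exact: norm_continuous.
move=> b _.
have b2 : (z : prejet R n).2 @[z --> b] --> b.2 by exact: cvg_snd.
exact: (cvg_norm (cvgB (cvg_trmx b2) b2)).
Qed.

End JetSections.

(** * Bundle metrics and small jets *)

Section BundleMetric.
Context {R : realType} {n : nat} {X : manifold R n}.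
Variables (g : X -> jetval R n -> jetval R n -> R) (hg : bundle_metric g).
Implicit Types (c d : chart R n X) (x : X) (u : X -> R).

Lemma metric0 x a : g x 0 a = 0.
Proof.
have [_ gl _ _] := hg; have := gl x 1 0 0 a.
by rewrite scaler0 addr0 mul1r; lra.
Qed.

Lemma metricZ x (t : R) a : g x (t *: a) (t *: a) = t ^+ 2 * g x a a.
Proof.
have [gs gl _ _] := hg.
have gZ b e : g x (t *: b) e = t * g x b e.
  by have := gl x t b 0 e; rewrite addr0 metric0 addr0.
by rewrite gZ gs gZ mulrA expr2.
Qed.

Lemma metric_ge0 x a : 0 <= g x a a.
Proof.
have [_ _ gp _] := hg.
by have [->|a0] := eqVneq a 0; [rewrite metric0|exact/ltW/gp].
Qed.

Lemma chart_jet0 c x : jcomp (chart_jet c x 0) = 0.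
Proof.
have := chart_jet_linear c x (-1) 0 0.
by rewrite scaler0 addr0 scaleN1r addNr.
Qed.

Lemma chart_jetZ c x (t : R) b :
  jcomp (chart_jet c x (t *: b)) = t *: jcomp (chart_jet c x b).
Proof. by have := chart_jet_linear c x t b 0; rewrite addr0 chart_jet0 addr0. Qed.

Lemma chart_jet_neq0 c x b : atlas c -> cdom c x -> b != 0 -> b.2^T = b.2 ->
  jcomp (chart_jet c x b) != 0.
Proof.
move=> ac cx b0 bs; apply: contra_neq b0 => Jb0.
have : chart_jet c x b = chart_jet c x 0.
  by congr Jet; rewrite -[LHS]/(jcomp (chart_jet c x b)) Jb0 -(chart_jet0 c x).
move=> /(chart_jet_inj ac cx)/symjet_eqP[b1].
rewrite bs trmx0 addr0 => b2; rewrite (surjective_pairing b) b1.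
congr (_, _); apply/matrixP => i j; have /matrixP/(_ i j) := b2.
by rewrite !mxE; lra.
Qed.

(* Compactness of the unit sphere of symmetric jets turns pointwise positivity
   of the metric into a lower bound that is uniform in the base point. *)
Lemma small_jets_near c x0 (A : set (prejet R n)) : atlas c -> cdom c x0 ->
  nbhs (0 : prejet R n) A -> exists2 lam : R, 0 < lam & \forall x \near x0, forall j,
    g x j j < lam -> exists2 b, A b & Jet x j = chart_jet c x b.
Proof.
move=> ac cx0 /nbhs_norm0P[e /= e0 eA].
pose r := e / 2; have r0 : 0 < r by rewrite /r divr_gt0.
have re : r < e by rewrite /r; lra.
pose S := [set b : prejet R n | `|b| = r /\ b.2^T = b.2].
have cS : compact S := @compact_prejet_sphere R n r.
pose P (p : X * R) (b : prejet R n) :=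
  p.2 < g p.1 (jcomp (chart_jet c p.1 b)) (jcomp (chart_jet c p.1 b)).
have [gs gl gp gc] := hg.
(* Near-covering form of compactness: it is enough to bound the metric below near each single [b] of
   the sphere, jointly in the base point and the threshold. *)
have [[A1 B1] /= [A1x B1l] AB1] : \forall p \near filter_prod (nbhs x0) (0 : R)^'+,
    S `<=` P p.
  move/compact_near_coveringP : cS; apply => b [br bs].
  pose G := filter_prod (nbhs b) (filter_prod (nbhs x0) (0 : R)^'+).
  have FG : Filter G by exact: filter_prod_filter.
  have b0 : b != 0 by rewrite -normr_eq0 br gt_eqF.
  have g0 : 0 < g x0 (jcomp (chart_jet c x0 b)) (jcomp (chart_jet c x0 b)).
    by apply: gp; exact: chart_jet_neq0.
  have c1 : p.1 @[p --> G] --> b by exact: cvg_fst.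
  have c2 : p.2 @[p --> G] --> filter_prod (nbhs x0) (0 : R)^'+ by exact: cvg_snd.
  have c21 : p.2.1 @[p --> G] --> x0 by apply: (cvg_comp _ _ c2); exact: cvg_fst.
  have c22 : p.2.2 @[p --> G] --> (0 : R)^'+ by apply: (cvg_comp _ _ c2); exact: cvg_snd.
  have cJ := cvg_chart_jet ac cx0 c21 c1.
  have cg := cvg_comp _ _ (cJ FG) (gc (chart_jet c x0 b)).
  set a := g x0 _ _ in g0.
  have a2 : a / 2 < a by lra.
  have n1 : \forall p \near G, a / 2 < g p.2.1 (jcomp (chart_jet c p.2.1 p.1))
      (jcomp (chart_jet c p.2.1 p.1)) by exact: (cvgr_gt _ cg _ a2).
  have n2 : \forall p \near G, p.2.2 < a / 2.
    by apply: (c22 [set l | l < a / 2]); apply: nbhs_right_lt; rewrite divr_gt0.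
  have : G (fun p => P p.2 p.1).
    apply: (@filterS _ G FG _ _ _ (@filterI _ G FG _ _ n1 n2)) => -[b' [x l]] [/= h1 h2].
    exact: lt_trans h2 h1.
  by [].
have [lam [Bl l0]] := filter_ex (filterI B1l (nbhs_right_gt 0)).
exists lam => //.
apply: filterS (filterI A1x (near_cdom cx0)) => x [A1x' cx] j jlam.
have [b Jb] := @chart_jet_surj _ _ _ c (Jet x j) ac cx.
exists (unsymjet b); last exact: Jb.
apply: eA => /=; rewrite ltNge; apply/negP => eb.
set s := unsymjet b in Jb eb.
have sb0 : 0 < `|s| by exact: lt_le_trans eb.
(* A prejet outside the ball is scaled back to the sphere by [t <= 1]; its metric value
   [t ^+ 2 * g x j j] is then still below [lam], against the bound on the sphere. *)
pose t := r / `|s|.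
have t0 : 0 < t by rewrite divr_gt0.
have t1 : t <= 1 by rewrite /t ler_pdivrMr// mul1r; apply: le_trans eb; exact: ltW.
have St : S (t *: s).
  split; first by rewrite normrZ gtr0_norm// /t divfK// gt_eqF.
  by rewrite /= linearZ/= symm_tr.
have := AB1 (x, lam) (conj A1x' Bl) _ St; rewrite /P/=.
rewrite -[X in _ < g _ X X]/(jcomp (chart_jet c x (t *: s))) chart_jetZ metricZ.
have -> : jcomp (chart_jet c x s) = j by rewrite -Jb.
apply/negP; rewrite -leNgt; apply: le_trans (ltW jlam).
by rewrite ler_piMl ?metric_ge0// expr_le1// ltW.
Qed.

End BundleMetric.

(** * Perturbation of strictly subharmonic functions *)

Section Perturbation.
Context {R : realType} {n : nat} {X : manifold R n}.
Implicit Types (c d : chart R n X) (x : X) (u : X -> R).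

Lemma jet2_linear u v x (t : R) : C2_near x u -> C2_near x v ->
  jcomp (jet2 (fun z => t * u z + v z) x) =
  t *: jcomp (jet2 u x) + jcomp (jet2 v x).
Proof.
move=> uC vC.
have := prejet_linear t (chart_at_atlas x) (chart_at_dom x) uC vC.
by move/(congr1 (@symjet R n)); rewrite symjet_linear.
Qed.

Lemma near_C2_near u x0 : C2_near x0 u -> \forall x \near x0, C2_near x u.
Proof.
move=> [U [oU Ux uC]]; apply: filterS (open_nbhs_nbhs (conj oU Ux)) => x Ux'.
by exists U.
Qed.

(** In a fixed chart, the prejet of [psi - delta * q] at [x] plus a small prejet converges to that
    of [psi] at [x0], jointly as [x] tends to [x0], [delta] to [0] from above and the added prejet
    to [0]. As a neighbourhood of the limit, [M] contains a box of such jets; [small_jets_near] then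
    trades the added prejet for the metric bound [lam]. *)
Lemma strict_perturbation (g : X -> jetval R n -> jetval R n -> R)
    (M : set (J2 X)) (psi q : X -> R) x0 :
  bundle_metric g -> C2_near x0 psi -> C2_near x0 q ->
  interior M (jet2 psi x0) ->
  exists2 delta : R, 0 < delta & exists2 lam : R, 0 < lam &
  \forall x \near x0, forall j, g x j j < lam ->
    M (Jet x (j + jcomp (jet2 (fun z => (- delta) * q z + psi z) x))).
Proof.
move=> hg psiC qC Mpsi; pose c := chart_at x0.
have ac : atlas c := chart_at_atlas x0.
have cx0 : cdom c x0 := chart_at_dom x0.
pose b (z : X) (t : R) : prejet R n :=
  (- t) *: prejet_in c q z + prejet_in c psi z.
pose G := filter_prod (nbhs x0) (filter_prod (0 : R)^'+ (nbhs (0 : prejet R n))).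
have FG : Filter G by exact: filter_prod_filter.
have c1 : p.1 @[p --> G] --> x0 by exact: cvg_fst.
have c2 : p.2 @[p --> G] --> filter_prod (0 : R)^'+ (nbhs (0 : prejet R n)).
  exact: cvg_snd.
have c21 : p.2.1 @[p --> G] --> (0 : R)^'+ by apply: (cvg_comp _ _ c2); exact: cvg_fst.
have c210 : p.2.1 @[p --> G] --> (0 : R) by apply: cvg_trans c21 _; exact: cvg_within.
have c22 : p.2.2 @[p --> G] --> (0 : prejet R n).
  by apply: (cvg_comp _ _ c2); exact: cvg_snd.
have cq := cvg_comp _ _ c1 (cvg_prejet_in ac cx0 qC).
have cp := cvg_comp _ _ c1 (cvg_prejet_in ac cx0 psiC).
have cb : (p.2.2 + b p.1 p.2.1) @[p --> G] --> prejet_in c psi x0.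
  have Eab (a b' : prejet R n) : 0 + ((- (0 : R)) *: a + b') = b'.
    by rewrite oppr0 scale0r !add0r.
  have := cvgD c22 (cvgD (cvgZ (cvgN c210) cq) cp).
  move: (prejet_in c q x0) (prejet_in c psi x0) => a b' h; rewrite -(Eab a b'); exact: h.
have /(_ FG) cJ := cvg_chart_jet ac cx0 c1 cb.
have nM : nbhs (chart_jet c x0 (prejet_in c psi x0)) M.
  by rewrite -(jet2_chart_jet ac cx0 psiC).
have [[A1 A2] /= [A1x [[B1 B2] /= [B1d B20] AB2]] AB1] :
  G (fun p => M (chart_jet c p.1 (p.2.2 + b p.1 p.2.1))) := cJ _ nM.
have [delta [Bd d0]] := filter_ex (filterI B1d (nbhs_right_gt 0)).
exists delta => //.
have [lam l0 small] := small_jets_near hg ac cx0 B20.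
exists lam => //.
apply: filterS (filterI (filterI (A1x : nbhs x0 A1) small)
  (filterI (near_cdom cx0) (filterI (near_C2_near psiC) (near_C2_near qC)))).
move=> x [[A1x' smallx] [cx [psix qx]]] j /smallx[a Ba Ja].
have chiC : C2_near x (fun z => (- delta) * q z + psi z).
  exact: C2_nearD (C2_nearZ (- delta) qx) psix.
have E : jet2 (fun z => (- delta) * q z + psi z) x = chart_jet c x (b x delta).
  rewrite (jet2_chart_jet ac cx chiC).
  by rewrite (prejet_linear (- delta) ac cx qx psix).
have := AB1 (x, (delta, a)) (conj A1x' (AB2 (delta, a) (conj Bd Ba))).
rewrite /= -[X in chart_jet c x (X + _)]scale1r.
congr (M _); congr Jet.
rewrite -[LHS]/(jcomp (chart_jet c x (1 *: a + b x delta))) chart_jet_linear scale1r.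
by rewrite -Ja -E.
Qed.

End Perturbation.

(** * Upper semicontinuous functions *)

Section Usc.
Context {R : realType} {n : nat} {X : manifold R n}.
Implicit Types (Y K : set X) (u v : X -> \bar R).

Lemma usc_subset Y K u : K `<=` Y -> usc Y u -> usc K u.
Proof.
move=> KY uY x /KY Yx; have [uoo ua] := uY x Yx; split => // a /ua.
by rewrite !near_withinE; apply: filterS => y h /KY /h.
Qed.

Lemma usc_continuous Y (f : X -> R) :
  (forall x, Y x -> {for x, continuous f}) -> usc Y (EFin \o f).
Proof.
move=> fc x Yx; split; first exact: ltry.
move=> a; rewrite /= lte_fin => fa; apply: cvg_within.
exact: (cvgr_lt _ (fc x Yx) _ fa).
Qed.

Lemma uscD Y u v : usc Y u -> usc Y v -> usc Y (fun x => (u x + v x)%E).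
Proof.
move=> uY vY x Yx; have [uoo ua] := uY x Yx; have [voo va] := vY x Yx.
split; first exact: lte_add_pinfty.
move=> a uva.
(* Finite values share the slack evenly; a summand equal to [-oo] lies below any threshold, so the
   other one is served first. *)
have [p [q [up vq pq]]] : exists p q : R,
    [/\ (u x < p%:E)%E, (v x < q%:E)%E & p + q <= a].
  move: (u x) (v x) uoo voo uva => [r| |] [s| |]//= _ _.
  - rewrite -EFinD lte_fin => rsa.
    exists (r + (a - r - s) / 2), (s + (a - r - s) / 2).
    by split; rewrite ?lte_fin; lra.
  - by move=> _; exists (r + 1), (a - (r + 1)); split; rewrite ?lte_fin ?ltNyr//; lra.
  - by move=> _; exists (a - (s + 1)), (s + 1); split; rewrite ?lte_fin ?ltNyr//; lra.
  - by move=> _; exists a, 0; split; rewrite ?ltNyr//; lra.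
have := ua p up; have := va q vq; rewrite !near_withinE => vq' up'.
apply: filterS (filterI up' vq') => y [h1 h2] Yy.
by apply: lt_le_trans (lteD (h1 Yy) (h2 Yy)) _; rewrite -EFinD lee_fin.
Qed.

(** The superlevel sets are totally ordered by inclusion, hence generate a filter, which clusters at
    some [x0]. If [u x0 < u y], then [u] stays below [u y] near [x0], so the superlevel set of [y]
    cannot cluster there. *)
Lemma usc_compact_max K u : compact K -> K !=set0 -> usc K u ->
  exists2 x0, K x0 & forall x, K x -> (u x <= u x0)%E.
Proof.
move=> cK K0 uK.
pose B y := [set x | K x /\ (u y <= u x)%E].
have FB : ProperFilter (filter_from K B).
  apply: filter_from_proper; last by move=> y Ky; exists y.
  apply: filter_from_filter => // y z Ky Kz.
  have [yz|zy] := leP (u y) (u z).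
    by exists z => // x [Kx zx]; do 2 split => //; exact: le_trans zx.
  by exists y => // x [Kx yx]; do 2 split => //; exact: le_trans (ltW zy) yx.
have FK : filter_from K B K by have [y Ky] := K0; exists y => // x [].
have [x0 [Kx0 clx0]] := cK _ FB FK.
exists x0 => // y Ky; rewrite leNgt; apply/negP => x0y.
have [yoo _] := uK y Ky; have [_ ux0] := uK x0 Kx0.
have uyE : u y = (fine (u y))%:E.
  by rewrite fineK// fin_real// yoo andbT (le_lt_trans _ x0y)// leNye.
rewrite uyE in x0y.
have [z [[Kz yz] zy]] := clx0 _ _ (ex_intro2 _ _ y Ky (fun x => id)) (ux0 _ x0y).
by have := zy Kz; rewrite -uyE ltNge yz.
Qed.

End Usc.

(** * Coordinate boxes and squared distance *)

Section Localization.
Context {R : realType} {n : nat} {X : manifold R n}.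
Implicit Types (c d : chart R n X) (x : X).

(** [B] is a closed coordinate cube of half-width [r]. The last clause serves by contraposition: a
    boundary point has some coordinate at distance at least [r] from the centre. *)
Lemma chart_box c x0 (V : set X) : cdom c x0 -> nbhs x0 V ->
  exists2 r : R, 0 < r & exists B : set X,
    [/\ compact B, B x0, B `<=` V &
        forall x, B x -> (forall i, `|cfun c x 0 i - cfun c x0 0 i| < r) ->
          interior B x].
Proof.
move=> cx0 Vx0; set y0 := cfun c x0.
have Iy0 : (cfun c @` cdom c) y0 by exists x0.
have nI : nbhs y0 (cfun c @` cdom c).
  by apply: open_nbhs_nbhs; split => //; exact: cimg_open.
have nV : nbhs y0 (cinv c @^-1` V).
  by apply: (cinv_continuous Iy0); rewrite cfunK.
have : nbhs y0 ((cfun c @` cdom c) `&` (cinv c @^-1` V)) by exact: filterI.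
move=> /nbhs_ballP[e /= e0 eIV].
pose r := e / 2; have r0 : 0 < r by rewrite divr_gt0.
have re : r < e by rewrite /r; lra.
pose D := [set y : 'rV[R]_n | forall i, `|y 0 i - y0 0 i| <= r].
have De y : D y -> ball y0 e y.
  move=> Dy; split=> // a i; rewrite ord1 /ball/= distrC.
  exact: le_lt_trans (Dy i) re.
have cD : compact D.
  have := @rV_compact R n (fun i => `[y0 0 i - r, y0 0 i + r]%classic).
  move=> /(_ (fun i => @segment_compact R _ _)).
  congr compact; apply/seteqP; split=> y Dy i; have := Dy i; rewrite /= in_itv/=.
    by rewrite ler_distl.
  by rewrite ler_distl.
exists r => //; exists (cinv c @` D); split.
- apply: continuous_compact cD; apply: continuous_in_subspaceT => y.
  rewrite inE => /De/eIV[Iy _]; exact: cinv_continuous.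
- by exists y0; [move=> i; rewrite subrr normr0 ltW|rewrite cfunK].
- by move=> _ [y /De/eIV[_ Vy] <-].
- move=> x [y Dy yx]; have [[z cz zy] _] := eIV _ (De _ Dy).
  have cx : cdom c x by rewrite -yx -zy cfunK.
  move=> xr; have nr : \forall y \near cfun c x, forall i, `|(y : 'rV[R]_n) 0 i - y0 0 i| < r.
    apply: (@filter_forall _ _ (fun i => [set y : 'rV[R]_n | `|y 0 i - y0 0 i| < r])
      (nbhs (cfun c x))) => i.
    have ci : `|(w : 'rV[R]_n) 0 i - y0 0 i| @[w --> cfun c x] -->
        `|cfun c x 0 i - y0 0 i|.
      have cc := @coord_continuous R 1 n 0 i (cfun c x).
      exact: (cvg_norm (cvgB cc (cvg_cst _))).
    exact: (cvgr_lt _ ci _ (xr i)).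
  have nw : nbhs x (fun z => forall i, `|cfun c z 0 i - y0 0 i| < r).
    exact: chart_nbhs cx nr.
  apply: (@filterS _ (nbhs x) _ _ _ _ (filterI (near_cdom cx) nw)) => w [cw wr].
  exists (cfun c w); last by rewrite cfunK.
  by move=> i; apply: ltW; exact: wr.
Qed.

(** Twice the identity matrix offsets the factor [2^-1] of [quadpoly]; being a [jetfun], the
    function is of class C^2 on the chart domain. *)
Definition sqdist c x0 : X -> R :=
  jetfun c ((0, 0, (2 : R)%:M) : prejet R n) x0.

Lemma sqdistE c x0 x :
  sqdist c x0 x = \sum_i (cfun c x 0 i - cfun c x0 0 i) ^+ 2.
Proof.
rewrite /sqdist /jetfun quadpolyE /= add0r.
rewrite [X in X + _]big1 ?add0r => [|k _]; last by rewrite mxE mul0r.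
rewrite mulr_sumr; apply: eq_bigr => k _.
rewrite (bigD1 k)//= big1 => [|l lk].
  by rewrite !mxE eqxx/=; field.
by rewrite !mxE eq_sym (negbTE lk) mul0r.
Qed.

Lemma sqdist_center c x0 : sqdist c x0 x0 = 0.
Proof. by rewrite sqdistE big1// => i _; rewrite subrr expr0n. Qed.

Lemma sqdist_ge c x0 x (r : R) i : 0 <= r ->
  r <= `|cfun c x 0 i - cfun c x0 0 i| -> r ^+ 2 <= sqdist c x0 x.
Proof.
move=> r0 ri; rewrite sqdistE (bigD1 i)//=.
have : 0 <= \sum_(j | j != i) (cfun c x 0 j - cfun c x0 0 j) ^+ 2.
  by apply: sumr_ge0 => j _; exact: sqr_ge0.
have : r ^+ 2 <= (cfun c x 0 i - cfun c x0 0 i) ^+ 2.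
  by rewrite -[leRHS]real_normK ?num_real// lerXn2r// nnegrE.
by lra.
Qed.

End Localization.

(** * Subharmonicity with a margin *)

Section Shrink.
Context {R : realType} {n : nat} {X : manifold R n}.
Variables (g : X -> jetval R n -> jetval R n -> R) (hg : bundle_metric g).

(** A jet outside [F] at distance less than [r] would differ from [J] by a vector of squared length
    below [r ^+ 2], which the hypothesis forbids; [j = 0] gives [J] itself. *)
Lemma shrink_ball (F : set (J2 X)) (r : R) (J : J2 X) : 0 < r ->
  (forall j, g (jpos J) j j < r ^+ 2 -> F (Jet (jpos J) (j + jcomp J))) ->
  shrink g F r J.
Proof.
move=> r0 FJ; split.
  have := FJ 0; rewrite metric0// add0r exprn_gt0// => /(_ isT).
  by case: J {FJ}.
apply: le_ereal_inf_tmp => _ [j nFj <-]; rewrite lee_fin leNgt; apply/negP => jr.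
apply: nFj; set a := jcomp J - j in jr.
(* [- 1 *: a] is the vector from [jcomp J] to [j]. *)
have := FJ (- 1 *: a); rewrite metricZ// sqrrN expr1n mul1r => FJa.
have ga : g (jpos J) a a < r ^+ 2.
  have g0 := metric_ge0 hg (jpos J) a.
  by rewrite -(sqr_sqrtr g0) ltr_pXn2r// ?nnegrE ?sqrtr_ge0// ltW.
have := FJa ga; rewrite scaleN1r /a opprB subrK.
by [].
Qed.

Lemma jcomp_jet2_cst0 x : jcomp (jet2 (cst 0) x : J2 X) = 0.
Proof.
(* With [t = -1] the combination is again the zero function, while linearity makes its jet [0]. *)
have := jet2_linear (-1) (C2_near_cst x 0) (C2_near_cst x 0).
rewrite scaleN1r addNr => <-; congr (jcomp (jet2 _ x)).
by apply/funext => z; rewrite mulr0 addr0.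
Qed.

(** A test function [phi] for the new function yields the test function [phi - eps * chi + m] for
    [u]. Its jet lies in [F], property (N) removes [m], and adding [eps] times jets of [M] close to
    that of [chi] leads to a whole ball around the jet of [phi]. *)
Lemma subharmonic_perturb (F M : set (J2 X)) (Y : set X) (u : X -> \bar R)
    (chi : X -> R) (eps m lam : R) :
  fsum F (@negN R n X) `<=` F ->
  (forall x (t : R) j, 0 < t -> fibre M x j -> fibre M x (t *: j)) ->
  fsum F M `<=` F ->
  0 < eps -> 0 <= m -> 0 < lam -> usc Y u ->
  subharmonic F (interior Y) u ->
  (forall x, Y x -> C2_near x chi) ->
  (forall x, Y x -> forall j, g x j j < lam ->
     M (Jet x (j + jcomp (jet2 chi x)))) ->
  subharmonic_cpt (shrink g F (eps * Num.sqrt lam)) Y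
    (fun x => (u x + (eps * chi x - m)%:E)%E).
Proof.
move=> FN Mcone FM eps0 m0 lam0 uY [_ uF] chiC chiM.
have thetaC x : Y x -> C2_near x (fun z => eps * chi z + cst (- m) z).
  by move=> Yx; apply: C2_nearD (C2_nearZ _ (chiC x Yx)) (C2_near_cst x (- m)).
have uscY : usc Y (fun x => (u x + (eps * chi x - m)%:E)%E).
  apply: (uscD uY).
  apply: (@usc_continuous _ _ _ _ (fun z => eps * chi z + cst (- m) z)) => x Yx.
  exact: C2_near_continuous (thetaC x Yx).
split=> //; split; first exact: usc_subset (@interior_subset _ _) uscY.
move=> x phi Yx phiC uphi uphix.
have Yx' := interior_subset Yx.
(* The factor [1] brings the inner sum into the form of [jet2_linear]. *)
pose phi' z := (- eps) * chi z + (1 * phi z + cst m z).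
have E z : (u z - (phi' z)%:E = u z + (eps * chi z - m)%:E - (phi z)%:E)%E.
  rewrite -addeA -EFinN -EFinD; congr (_ + _%:E)%E.
  by rewrite /phi' /cst; ring.
have chix := chiC x Yx'.
have phimC : C2_near x (fun z => 1 * phi z + cst m z).
  exact: C2_nearD (C2_nearZ 1 phiC) (C2_near_cst x m).
have phi'C : C2_near x phi' := C2_nearD (C2_nearZ (- eps) chix) phimC.
have Fphi' : F (jet2 phi' x).
  apply: uF => //.
  - by apply: filterS uphi => z; rewrite E.
  - by rewrite E.
have J0 : jcomp (jet2 (cst m) x) + jcomp (jet2 (cst (- m)) x) = 0 :> jetval R n.
  have := jet2_linear 1 (C2_near_cst x m) (C2_near_cst x (- m)).
  rewrite scale1r => <-; rewrite -[RHS](jcomp_jet2_cst0 x).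
  by congr (jcomp (jet2 _ x)); apply/funext => z; rewrite /cst mul1r subrr.
pose Jphi := jcomp (jet2 phi x); pose Jchi := jcomp (jet2 chi x).
have FJ : F (Jet x (- eps *: Jchi + Jphi)).
  apply: FN; exists (jcomp (jet2 phi' x)), (jcomp (jet2 (cst (- m)) x)); split.
  - exact: Fphi'.
  - by exists (- m); rewrite ?oppr_le0.
  have J1 : jcomp (jet2 phi' x) = - eps *: Jchi +
    jcomp (jet2 (fun z => 1 * phi z + cst m z) x) := jet2_linear (- eps) chix phimC.
  have J2 : jcomp (jet2 (fun z => 1 * phi z + cst m z) x) = 1 *: Jphi +
    jcomp (jet2 (cst m) x) := jet2_linear 1 phiC (C2_near_cst x m).
  have alg (a b c d p q : jetval R n) : a = - eps *: c + b -> b = 1 *: p + d ->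
    d + q = 0 -> - eps *: c + p = a + q.
    by move=> -> -> dq; rewrite scale1r -!addrA dq addr0.
  exact: alg J1 J2 J0.
apply: shrink_ball => //; first by rewrite mulr_gt0// sqrtr_gt0.
move=> j; rewrite exprMn sqr_sqrtr ?ltW// => jlam.
(* Factoring out [eps] rescales [j] by [eps^-1], which turns the bound [eps ^+ 2 * lam] into
   [lam]. *)
apply: FM; exists (- eps *: Jchi + Jphi), (eps *: (eps^-1 *: j + Jchi)); split.
- exact: FJ.
- apply: Mcone => //; apply: chiM => //.
  by rewrite metricZ// exprVn mulrC ltr_pdivrMr ?exprn_gt0// mulrC.
- have alg (a b : jetval R n) : j + b = - eps *: a + b + eps *: (eps^-1 *: j + a).
    rewrite scalerDr scalerA divff ?gt_eqF// scale1r scaleNr.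
    by rewrite -addrA [b + (j + _)]addrA [b + j + _]addrC addKr addrC.
  exact: alg.
Qed.

End Shrink.

(** * Interior maximum and the comparison argument *)

Section Main.
Context {R : realType} {n : nat} {X : manifold R n}.

Lemma compact_upper_bound (psi : X -> R) (K : set X) :
  compact K -> K !=set0 -> (forall x, {for x, continuous psi}) ->
  exists2 C : R, 0 <= C & forall x, K x -> psi x <= C.
Proof.
move=> cK K0 psic.
have [|c _ cmax] := compact_EVT_max K0 cK (f := psi).
  by apply: continuous_subspaceT => x; exact: psic.
(* With [C >= 0], any value above [eps * C] is positive. *)
exists (Num.max 0 (psi c)); first by rewrite le_max lexx.
by move=> x Kx; rewrite le_max cmax ?orbT// inE.
Qed.

Lemma interior_max (psi : X -> R) (K : set X) (u v : X -> \bar R) x1 :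
  (forall x, {for x, continuous psi}) -> compact K ->
  usc K u -> usc K v ->
  (forall x, (closure K `\` interior K) x -> (u x + v x <= 0)%E) ->
  K x1 -> (0 < u x1 + v x1)%E ->
  exists eps mu : R, exists x0, [/\ 0 < eps, 0 < mu, interior K x0,
    (u x0 + v x0 + (eps * psi x0)%:E = mu%:E)%E &
    forall x, K x -> (u x + v x + (eps * psi x)%:E <= mu%:E)%E].
Proof.
move=> psic cK uK vK bd Kx1 uv1.
have K0 : K !=set0 by exists x1.
have [C C0 psiC] := compact_upper_bound cK K0 psic.
have uvoo x : K x -> (u x + v x < +oo)%E.
  by move=> Kx; apply: lte_add_pinfty; [have [] := uK x Kx|have [] := vK x Kx].
have uv1E : (u x1 + v x1 = (fine (u x1 + v x1))%:E)%E.
  by rewrite fineK// fin_real// uvoo// andbT (lt_trans _ uv1)// ltNyr.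
set s := fine _ in uv1E; rewrite uv1E lte_fin in uv1.
have Cx1 := psiC x1 Kx1.
(* Chosen so that [eps * (C - psi x1) < s]: the value of [w] at [x1] then exceeds [eps * C], which
   bounds [w] wherever [u + v <= 0], in particular on the boundary. *)
pose eps := s / (C - psi x1 + 1).
have d0 : 0 < C - psi x1 + 1 by lra.
have eps0 : 0 < eps by rewrite divr_gt0.
have epsd : eps * (C - psi x1 + 1) = s by rewrite /eps divfK// gt_eqF.
pose w x := (u x + v x + (eps * psi x)%:E)%E.
have wK : usc K w.
  apply: uscD; first exact: uscD.
  apply: (@usc_continuous _ _ _ _ (fun z => eps * psi z)) => x _.
  by apply: cvgM; [exact: cvg_cst|exact: psic].
have [x0 Kx0 wmax] := usc_compact_max cK K0 wK.
have w1 : (w x1 = (s + eps * psi x1)%:E)%E by rewrite /w uv1E -EFinD.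
have epsC : ((eps * C)%:E < w x1)%E.
  by rewrite w1 lte_fin; nra.
have w0C : ((eps * C)%:E < w x0)%E by apply: lt_le_trans epsC (wmax _ Kx1).
have w0E : (w x0 = (fine (w x0))%:E)%E.
  have [w0oo _] := wK x0 Kx0.
  by rewrite fineK// fin_real// w0oo andbT (lt_trans _ w0C)// ltNyr.
exists eps, (fine (w x0)), x0; split => //.
- rewrite w0E lte_fin in w0C; apply: le_lt_trans w0C.
  by rewrite mulr_ge0// ltW.
- apply: contrapT => nI.
  have uv0 : (u x0 + v x0 <= 0)%E.
    by apply: bd; split => //; exact: subset_closure.
  move: w0C; rewrite ltNge => /negP; apply.
  apply: le_trans (leeD2r _ uv0) _; rewrite add0e lee_fin.
  by rewrite ler_pM2l// psiC.
- by move=> x Kx; rewrite -w0E; exact: wmax.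
Qed.

End Main.

Unset Implicit Arguments.

Theorem theorem9p7 (R : realType) (n : nat) (X : manifold R n)
    (g : X -> jetval R n -> jetval R n -> R) (hg : bundle_metric g)
    (F : set (J2 X)) (hF : subequation F)
    (M : set (J2 X)) (hM : monotonicity_cone F M)
    (psi : X -> R) (hpsi : C2_on [set: X] psi)
    (hpsiM : strictly_subharmonic M psi)
    (hloc : local_weak_comparison g F) :
  comparison F [set: X].
Proof.
move=> K u v cK _ [uK uF] [vK vF] bd x1 Kx1; rewrite leNgt; apply/negP => uv1.
have psiC x : C2_near x psi by exists setT; split; [exact: openT|by []|exact: hpsi].
have [eps [mu [x0 [eps0 mu0 Ix0 w0 wmax]]]] :=
  interior_max (fun x => C2_near_continuous (psiC x)) cK uK vK bd Kx1 uv1.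
pose c := chart_at x0.
have ac : atlas c := chart_at_atlas x0.
have cx0 : cdom c x0 := chart_at_dom x0.
pose q := sqdist c x0.
have qC x : cdom c x -> C2_near x q by exact: jetfun_C2_near.
have [delta delta0 [lam lam0 chiM]] :=
  strict_perturbation hg (psiC x0) (qC x0 cx0) (hpsiM x0).
pose chi z := (- delta) * q z + psi z.
have [U [oU Ux0] wcU] := hloc x0.
(* All these conditions hold near [x0], so one small box satisfies them together. *)
have nV : nbhs x0 (U `&` (interior K `&` (cdom c `&` [set x | forall j, g x j j < lam ->
    M (Jet x (j + jcomp (jet2 chi x)))]))).
  apply: filterI; first exact: open_nbhs_nbhs.
  apply: filterI; first exact: nbhs_interior.
  by apply: filterI => //; exact: near_cdom.
have [r r0 [B [cB Bx0 BV Bint]]] := chart_box cx0 nV.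
have BK : B `<=` K by move=> x /BV[_ [/interior_subset]].
(* Lower bound of the penalty [eps * delta * q] on the boundary of the box. *)
pose a := eps * delta * r ^+ 2.
have a0 : 0 < a by rewrite /a !mulr_gt0// exprn_gt0.
(* [m] is nonnegative for (N), at least [mu - a] to make the sum nonpositive on the boundary of [B],
   and below [mu] to keep it positive at [x0]. *)
pose m := Num.max 0 (mu - a).
have m0 : 0 <= m by rewrite le_max lexx.
have mmu : m < mu by rewrite gt_max mu0/= ltrBlDr ltrDl.
have mua : mu - a <= m by rewrite le_max lexx orbT.
have [FP FN _ _ _] := hF.
have [_ Mcone FM] := hM.
have chiC x : B x -> C2_near x chi.
  move=> /BV[_ [_ [cx _]]].
  exact: C2_nearD (C2_nearZ (- delta) (qC x cx)) (psiC x).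
have uB : subharmonic_cpt (shrink g F (eps * Num.sqrt lam)) B
    (fun x => (u x + (eps * chi x - m)%:E)%E).
  apply: (subharmonic_perturb hg FN Mcone FM eps0 m0 lam0) => //.
  - exact: usc_subset BK uK.
  - split; first by apply: usc_subset uK => x /interior_subset/BK.
    move=> x phi Bx; have [_] := uF; apply; exact: interiorS BK _ Bx.
  - by move=> x /BV[_ [_ []]].
have vB : subharmonic_cpt (dual F) B v.
  split; first exact: usc_subset BK vK.
  split; first by apply: usc_subset vK => x /interior_subset/BK.
  move=> x phi Bx; have [_] := vF; apply; exact: interiorS BK _ Bx.
have uvE x : ((u x + (eps * chi x - m)%:E) + v x =
  u x + v x + (eps * psi x)%:E - (eps * delta * q x + m)%:E)%E.
  rewrite addeAC -[RHS]addeA -EFinN -EFinD; congr (_ + _%:E)%E.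
  by rewrite /chi; ring.
have BU : B `<=` U by move=> x /BV[].
have lam1 : 0 < eps * Num.sqrt lam by rewrite mulr_gt0// sqrtr_gt0.
have zmp := wcU B _ _ _ cB BU lam1 uB vB.
(* At the centre [q] vanishes and the sum is [mu - m], so (ZMP) would force [mu <= m]. *)
have := zmp _ x0 Bx0.
rewrite uvE w0 /q sqdist_center mulr0 add0r -EFinN -EFinD lee_fin => bad.
suff : mu - m <= 0 by rewrite subr_le0 leNgt mmu.
apply: bad => x [clBx nBx].
(* Compact sets of a Hausdorff space are closed, so the boundary point lies in [B]. *)
have Bx : B x by apply: (compact_closed (@manifold_hausdorff _ _ X) cB).
have [i ri] : exists i, r <= `|cfun c x 0 i - cfun c x0 0 i|.
  apply: contrapT => nri; apply: nBx; apply: Bint => // i.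
  by rewrite ltNge; apply/negP => ri; apply: nri; exists i.
have qr := sqdist_ge (ltW r0) ri.
rewrite uvE.
apply: le_trans (leeD2r _ (wmax x (BK x Bx))) _.
rewrite -EFinN -EFinD lee_fin.
have : a <= eps * delta * q x by rewrite /a ler_pM2l// mulr_gt0.
by lra.
Qed.
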